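(* Let $n\ge 2$ and let $(\tau_1,\dots,\tau_{n-1})$ be a uniformly random increasing factorisation of size $n$, with $\tau_i=(a_i\ b_i)$ and $a_i<b_i$. Then: 1. Almost surely, the sets $\{a_1,\dots,a_{n-1}\}$ and $\{b_1,\dots,b_{n-1}\}$ are disjoint and their union is $\{1,2,3,\dots,n\}$. 2. For all $k\in\{1,\dots,n-1\}$, $$\mathbb P\left(\#\{a_1,\dots,a_{n-1}\}=k\right)=\frac{n+1}{n-1}\binom{n-1}{k}\binom{n-1}{k-1}\binom{2n}{n}^{-1},$$ and, as $n\to\infty$, the convergence $$\frac{\#\{a_1,\dots,a_{n-1}\}-n/2}{\sqrt n}\longrightarrow \mathcal N(0,1/8)$$ holds in distribution, where $\mathcal N(0,1/8)$ denotes a centered normal distribution with variance $1/8$.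
   Context: A minimal factorisation of size $n\ge 2$ is a tuple $(\tau_1,\dots,\tau_{n-1})$ of transpositions of $\{1,\dots,n\}$ such that $\tau_{n-1}\circ\dots\circ\tau_1=(1\ 2\ \dots\ n)$ (the $n$-cycle $1\mapsto2\mapsto\dots\mapsto n\mapsto1$; $\tau_1$ is applied first). Writing $\tau_i=(a_i\ b_i)$ with $a_i<b_i$, it is an increasing factorisation if $a_1\le a_2\le\dots\le a_{n-1}$ (weakly increasing). The set of increasing factorisations of size $n$ is finite; ''uniformly random'' means uniform on this set. $\#A$ denotes the cardinality of $A$.
   Formalization: The printed probability is false for every n≥2 (for n=2, k=1 it gives 1/2, the true value is 1); the formal statement has n/(n-1)·C(n-1,k)·C(n-1,k-1)/C(2n-2,n-1) in its place. *)

(* Defs.v *)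
From HB Require Import structures.
From mathcomp Require Import all_boot all_order all_algebra all_fingroup.
From mathcomp Require Import all_classical all_reals all_analysis.
Set Implicit Arguments.
Unset Strict Implicit.
Unset Printing Implicit Defensive.
Import Order.TTheory GRing.Theory Num.Theory.
Import numFieldNormedType.Exports.

(* The labels 1, ..., n are shifted to
   0, ..., n.-1, the elements of 'I_n; this preserves the order of labels. *)

Section Factorisations.
Variable n : nat.
Implicit Types (s : 'S_n) (t : n.-1.-tuple 'S_n).

Definition long_cycle : 'S_n := perm (@ordS_inj n).

Definition is_transposition s : bool :=
  [exists a, exists b, (a != b) && (s == tperm a b)].

Definition transposition_ends s (a b : 'I_n) : bool :=
  (a < b)%N && (s == tperm a b).

(* The product of permutations is (s * s') x = s' (s x), so that in the product
   below the head of t is applied first. *)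
Definition minimal_factorisation t : bool :=
  all is_transposition t && ((\prod_(s <- t) s)%g == long_cycle).

Definition increasing_factorisation t : bool :=
  minimal_factorisation t &&
  [forall i : 'I_n.-1, forall j : 'I_n.-1, (i <= j)%N ==>
    [forall a, forall b, forall a', forall b',
      transposition_ends (tnth t i) a b ==>
      transposition_ends (tnth t j) a' b' ==> (a <= a')%N]].

Definition increasing_factorisations : {set n.-1.-tuple 'S_n} :=
  [set t | increasing_factorisation t]%SET.

Definition lower_ends t : {set 'I_n} :=
  [set a | [exists i, exists b, transposition_ends (tnth t i) a b]]%SET.

Definition upper_ends t : {set 'I_n} :=
  [set b | [exists i, exists a, transposition_ends (tnth t i) a b]]%SET.

End Factorisations.

Local Open Scope classical_set_scope.
Local Open Scope ring_scope.

(* The first conjunct is measurability of X for the discrete sigma-algebra on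
   the finite type E.  If A is empty the second one is contradictory. *)
Definition uniformly_distributed (R : realType) d (T : measurableType d)
    (P : probability T R) (E : finType) (A : {set E}) (X : T -> E) : Prop :=
  (forall e, measurable (X @^-1` [set e])) /\
  (forall e, P (X @^-1` [set e]) = ((e \in A)%:R / #|A|%:R)%:E).

(* Pointwise convergence of the distribution functions at every continuity
   point of the limit; the X n may live on different probability spaces. *)
Definition cvg_in_distribution (R : realType) (d : nat -> measure_display)
    (T : forall n, measurableType (d n)) (P : forall n, probability (T n) R)
    (X : forall n, T n -> R)
    (mu : probability (measurableTypeR R) R) : Prop :=
  forall x : R,
    {for x, continuous (fun y : R => mu `]-oo, y]%classic)} ->
    P n [set w | X n w <= x] @[n --> \oo] --> mu `]-oo, x]%classic.

(* Main.v *)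
From HB Require Import structures.
Require Import Defs.
From mathcomp Require Import all_boot all_order all_algebra all_fingroup.
From mathcomp Require Import all_classical all_reals all_analysis.
From mathcomp Require Import measurable_realfun zify ring lra.
Set Implicit Arguments.
Unset Strict Implicit.
Unset Printing Implicit Defensive.
Import Order.TTheory GRing.Theory Num.Theory.
Import numFieldNormedType.Exports.

(* Reading an increasing factorisation backwards builds a plane forest: the
   product of the transpositions with lower end >= a is a product of cycles on
   consecutive intervals of {a, ..., n}, one per tree, and the transpositions
   with lower end a - 1 join the first r of these cycles and a - 1 into a single
   cycle, for an arbitrary r.  No other shape is possible, because a product of m
   transpositions has at least n - m cycles.  So increasing factorisations of
   size n are plane trees with n nodes labelled in depth-first order; the lower
   ends are the inner nodes, the upper ends are the leaves, and the Narayana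
   numbers count these trees by inner nodes.

   The number of lower ends thus has a law proportional to
   w(k) = C(n-1,k) C(n-1,k-1).  The quotients w(k+1)/w(k) give two-sided Gaussian
   bounds on w(k)/w(n/2), so that the rescaled step functions converge pointwise
   and dominatedly to a multiple of the normal density.  Dividing by the total
   mass, which satisfies the same limit theorem, removes the normalisation, so
   that no form of Stirling's formula is needed. *)

(** * Products of stars of transpositions *)

Definition tperm_prod (T : finType) (t : seq (T * T)) : {perm T} :=
  (\prod_(p <- t) tperm p.1 p.2)%g.

(* The product of [star (a :: v)], leftmost factor applied first, is the cycle
   a -> v_0 -> v_1 -> ... -> a. *)
Definition star (T : Type) (u : seq T) : seq (T * T) :=
  if u is a :: v then [seq (a, b) | b <- v] else [::].

Definition stars (T : Type) (L : seq (seq T)) : seq (T * T) :=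
  flatten (map (@star T) L).

Lemma tperm_prod_cons (T : finType) (p : T * T) t :
  tperm_prod (p :: t) = (tperm p.1 p.2 * tperm_prod t)%g.
Proof. by rewrite /tperm_prod big_cons. Qed.

Lemma tperm_prod_cat (T : finType) (t1 t2 : seq (T * T)) :
  tperm_prod (t1 ++ t2) = (tperm_prod t1 * tperm_prod t2)%g.
Proof. by rewrite /tperm_prod big_cat. Qed.

Lemma stars_cat (T : Type) (L1 L2 : seq (seq T)) :
  stars (L1 ++ L2) = stars L1 ++ stars L2.
Proof. by rewrite /stars map_cat flatten_cat. Qed.

Lemma stars_cons (T : Type) (u : seq T) L : stars (u :: L) = star u ++ stars L.
Proof. by []. Qed.

Lemma star_sub (T : eqType) (u : seq T) p : p \in star u -> p.1 \in u /\ p.2 \in u.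
Proof.
case: u => // a v /mapP[b bv ->] /=; by rewrite !inE eqxx bv orbT.
Qed.

Lemma stars_sub (T : eqType) (L : seq (seq T)) p :
  p \in stars L -> p.1 \in flatten L /\ p.2 \in flatten L.
Proof.
move=> /flattenP[_ /mapP[u uL ->] /star_sub[p1 p2]].
by split; apply/flattenP; exists u.
Qed.

(** Used with [pred1 x] to find fixed points and with the support of one star to confine an
    orbit. *)
Lemma tperm_prod_stable (T : finType) (S : pred T) (t : seq (T * T)) x :
  {in t, forall p, S p.1 = S p.2} -> S (tperm_prod t x) = S x.
Proof.
elim: t x => [|[a b] t IH] x H; first by rewrite /tperm_prod big_nil perm1.
have Hab : S a = S b by apply: (H (a, b)); rewrite inE eqxx.
rewrite tperm_prod_cons permM IH; last by move=> p pt; apply: H; rewrite inE pt orbT.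
by case: tpermP => //= ->.
Qed.

Lemma tperm_prod_fix (T : finType) (t : seq (T * T)) x :
  {in t, forall p, p.1 != x /\ p.2 != x} -> tperm_prod t x = x.
Proof.
move=> H; apply/eqP; have /= -> := @tperm_prod_stable _ (pred1 x) t x.
- exact: eqxx.
- by move=> p /H[/= /negPf -> /negPf ->].
Qed.

Lemma stars_fix (T : finType) (L : seq (seq T)) x :
  x \notin flatten L -> tperm_prod (stars L) x = x.
Proof.
move=> xL; apply: tperm_prod_fix => p /stars_sub[p1 p2].
by split; apply: contraNneq xL => <-.
Qed.

Lemma star_fix (T : finType) (u : seq T) x : x \notin u -> tperm_prod (star u) x = x.
Proof.
by move=> xu; have := @stars_fix _ [:: u] x; rewrite /stars /= !cats0; apply.
Qed.

Lemma star_rcons (T : Type) (a b : T) v :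
  star (a :: rcons v b) = rcons (star (a :: v)) (a, b).
Proof. by rewrite /= map_rcons. Qed.

Lemma star_last (T : finType) (a : T) v : uniq (a :: v) ->
  tperm_prod (star (a :: v)) (last a v) = a.
Proof.
case/lastP: v => [|v b] U; first by rewrite /tperm_prod big_nil perm1.
rewrite last_rcons star_rcons -cats1 tperm_prod_cat permM.
rewrite star_fix; first by rewrite tperm_prod_cons /tperm_prod big_nil mulg1 tpermR.
by move: U; rewrite -rcons_cons rcons_uniq => /andP[].
Qed.

Lemma star_cut (T : finType) (a : T) u y : u != [::] -> uniq (a :: u ++ y) ->
  (tperm a (last a u) * (tperm_prod (star u) * tperm_prod (star (a :: y))))%g
  = tperm_prod (star (a :: u ++ y)).
Proof.
case: u => // x0 u _ U.
rewrite /= map_cat -cat_cons tperm_prod_cat mulgA; congr mulg.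
have {U} U : uniq (a :: x0 :: u) by move: U; rewrite -cat_cons cat_uniq => /andP[].
have [aN Uu] : a \notin x0 :: u /\ uniq (x0 :: u) by move: U => /andP[].
(* The star of [x0 :: u] fixes [a] and sends the last element to [x0], so conjugation by it turns
   [tperm a (last x0 u)] into [tperm a x0]. *)
have -> : (tperm a (last x0 u) * tperm_prod [seq (x0, b) | b <- u])%g =
  (tperm_prod [seq (x0, b) | b <- u] * tperm a x0)%g.
  have := tpermJ a (last x0 u) (tperm_prod (star (x0 :: u))).
  rewrite (star_fix aN) (star_last Uu) => <-.
  by rewrite conjgE !mulgA mulgV mul1g.
rewrite tperm_prod_cons /=.
(* It remains to carry (a x0) to the front; on its way it turns each factor (x0 z) into (a z). *)
elim: u aN {U} Uu => [|z u IH] /= aN Uu.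
  by rewrite /tperm_prod !big_nil mul1g mulg1.
rewrite !tperm_prod_cons /= mulgA.
have -> : (tperm a x0 * tperm a z = tperm x0 z * tperm a x0)%g.
  have := tpermJ a z (tperm a x0).
  rewrite tpermL tpermD; last 2 first.
  - by apply: contraNneq aN => <-; rewrite !inE eqxx orbT.
  - by apply: contraTneq Uu => <-; rewrite !inE eqxx.
  by rewrite conjgE tpermV => <-; rewrite -!mulgA tperm2 mulg1.
rewrite -!mulgA; congr mulg; apply: IH.
  by apply: contra aN; rewrite !inE => /orP[->//|->]; rewrite !orbT.
by move: Uu; rewrite /= inE negb_or -andbA => /and4P[_ -> _ ->].
Qed.

(* The transposition (a, last a u) cuts u off the cycle a :: u ++ y. *)
Lemma stars_cut (T : finType) (a : T) acc u y rest : u != [::] ->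
  uniq (flatten (acc ++ (a :: u ++ y) :: rest)) ->
  (tperm a (last a u) * tperm_prod (stars (rcons acc u ++ (a :: y) :: rest)))%g
  = tperm_prod (stars (acc ++ (a :: u ++ y) :: rest)).
Proof.
move=> u0; rewrite flatten_cat /= -cat_cons uniq_catCA -cat_cons !cat_uniq.
move=> /and3P[U /hasPn D _].
rewrite -cats1 -catA !stars_cat !stars_cons !tperm_prod_cat /=.
have -> : tperm_prod (stars [::] : seq (T * T)) = 1%g by rewrite /tperm_prod big_nil.
rewrite !mulg1 ?mul1g.
rewrite -cat_uniq in U; have /= <- := star_cut u0 U.
rewrite !mulgA; congr (_ * _ * _ * _)%g.
(* The stars in [acc] fix both [a] and [last a u], hence commute with the transposition. *)
have := tpermJ a (last a u) (tperm_prod (stars acc)).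
have Df x : x \in a :: u -> x \notin flatten acc.
  move=> xu; apply/negP => xa.
  have := D x; rewrite mem_cat xa => /(_ isT) /=; rewrite -cat_cons mem_cat.
  by rewrite xu.
rewrite !stars_fix ?Df ?mem_head //; last by apply: mem_last.
move=> {2}<-.
by rewrite conjgE !mulgA mulgV mul1g.
Qed.

(** * Cycle counts of products of transpositions *)

Lemma porbits1 (T : finType) : #|porbits (1 : {perm T})| = #|T|.
Proof.
rewrite /porbits card_imset // => x y E.
have : y \in porbit (1%g : {perm T}) x by rewrite E porbit_id.
by move=> /porbitP[i ->]; rewrite expg1n perm1.
Qed.

(** A transposition changes the number of cycles by at most one, and the identity has [#|T|]
    cycles. *)
Lemma porbits_prod_ge (T : finType) (t : seq (T * T)) :
  #|T| <= #|porbits (tperm_prod t)| + size t.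
Proof.
elim: t => [|[a b] t IH]; first by rewrite /tperm_prod big_nil porbits1 addn0.
rewrite tperm_prod_cons /=.
have := porbits_mul_tperm (tperm_prod t) a b => /=.
case: (eqVneq a b) => [->|_]; first by rewrite tperm1 mul1g; move: IH => /=; lia.
by case: (a \in _) => /= E; move: IH E => /=; lia.
Qed.

(** The equality case of [porbits_prod_ge]: each new edge (a, b) joins the fixed point [b] to the
    cycle of [a], so every edge lowers the number of cycles by one. *)
Lemma porbits_stars (T : finType) (L : seq (seq T)) : uniq (flatten L) ->
  #|porbits (tperm_prod (stars L))| + size (stars L) = #|T|.
Proof.
elim: L => [_|u L IH]; first by rewrite /tperm_prod big_nil porbits1 addn0.
case: u => [//|a v]; elim: v => [|b v IHv].
  by move=> /= /andP[_ U]; rewrite stars_cons /=; apply: IH.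
rewrite /= inE negb_or -andbA => /and4P[ab aN bN' U'].
have bN : b \notin a :: v ++ flatten L by rewrite inE negb_or eq_sym ab.
have U : uniq (a :: v ++ flatten L) by rewrite /= aN.
rewrite stars_cons /= tperm_prod_cons /=.
have := IHv U; rewrite stars_cons /=.
set t := (_ ++ _); set s := tperm_prod t => E.
have sb : s b = b.
  apply: (@stars_fix _ ((a :: v) :: L)).
  by apply: contra bN => /=; rewrite !inE !mem_cat.
have nab : a \notin porbit s b.
  by apply/negP => /porbitP[i ai]; move: ab; rewrite ai permX_fix ?eqxx.
have := porbits_mul_tperm s a b => /=; rewrite nab ab /=; lia.
Qed.

(** * Forests and increasing factorisations *)

Definition root_edges (T : Type) (a : T) (us : seq (seq T)) : seq (T * T) :=
  [seq (a, last a u) | u <- us].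

Definition add_root (T : Type) (a : T) (x : seq (seq T) * seq (T * T)) (r : nat) :
    seq (seq T) * seq (T * T) :=
  ((a :: flatten (take r x.1)) :: drop r x.1, root_edges a (take r x.1) ++ x.2).

(* A pair (L, t) in [forests s] consists of the depth-first node lists of the
   trees of a forest on s, and of a factorisation t of the product of the cycles
   in L: each parent a contributes, child by child, the transpositions (a, b) with
   b the last descendant of the child. *)
Fixpoint forests (T : Type) (s : seq T) : seq (seq (seq T) * seq (T * T)) :=
  if s is a :: s' then
    [seq add_root a x r | x <- forests s', r <- iota 0 (size x.1).+1]
  else [:: ([::], [::])].

Lemma forests_ind (T : eqType) (Q : seq T -> seq (seq T) * seq (T * T) -> Prop) :
  Q [::] ([::], [::]) ->
  (forall a s (x : seq (seq T) * seq (T * T)) r,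
     x \in forests s -> Q s x -> r <= size x.1 -> Q (a :: s) (add_root a x r)) ->
  forall s (x : seq (seq T) * seq (T * T)), x \in forests s -> Q s x.
Proof.
move=> Q0 QS; elim=> [|a s IH] x; first by rewrite inE => /eqP ->.
move=> /allpairsPdep [x' [r [x's rs ->]]]; rewrite mem_iota /= add0n ltnS in rs.
by apply: QS => //; apply: IH.
Qed.

Lemma forests_flatten (T : eqType) (s : seq T) (x : seq (seq T) * seq (T * T)) : x \in forests s ->
  flatten x.1 = s.
Proof.
elim/forests_ind: s x / => // a s x r _ <- _ /=.
by rewrite -flatten_cat cat_take_drop.
Qed.

Lemma forests_nonempty (T : eqType) (s : seq T) (x : seq (seq T) * seq (T * T)) : x \in forests s ->
  [::] \notin x.1.
Proof.
elim/forests_ind: s x / => // a s x r _ IH _ /=; rewrite inE /=.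
by apply: contra IH => /mem_drop.
Qed.

Lemma forests_size (T : eqType) (s : seq T) (x : seq (seq T) * seq (T * T)) : x \in forests s ->
  size x.2 + size x.1 = size s.
Proof.
elim/forests_ind: s x / => // a s x r _ IH rx /=.
by rewrite size_cat size_map size_takel // size_drop -IH; lia.
Qed.

Lemma forests_mem (T : eqType) (s : seq T) (x : seq (seq T) * seq (T * T)) p :
  x \in forests s -> p \in x.2 -> p.1 \in s /\ p.2 \in s.
Proof.
elim/forests_ind: s x / => // a s x r xs IH rx /=; rewrite mem_cat !inE.
case/orP => [/mapP[u ux ->] /=|/IH[-> ->]]; last by rewrite !orbT.
rewrite eqxx; split=> //; rewrite -(forests_flatten xs).
have : u != [::].
  by apply: contraNneq (forests_nonempty xs) => <-; apply: mem_take ux.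
case: u ux => // b v ux _ /=; apply/orP; right.
by apply/flattenP; exists (b :: v); rewrite ?mem_last // (mem_take ux).
Qed.

(** Iterates [stars_cut]: each transposition cuts the next child off the cycle of [a], and [acc]
    collects the cycles already cut off. *)
Lemma root_edges_prod (T : finType) (a : T) acc us rest :
  [::] \notin us -> uniq (flatten (acc ++ (a :: flatten us) :: rest)) ->
  (tperm_prod (root_edges a us) * tperm_prod (stars (acc ++ us ++ rest)))%g
  = tperm_prod (stars (acc ++ (a :: flatten us) :: rest)).
Proof.
elim: us acc => [|u us IH] acc.
  by move=> _ _; rewrite {1}/tperm_prod big_nil mul1g !stars_cat.
rewrite inE negb_or => /andP[u0 us0] U /=.
rewrite -stars_cut //; last by rewrite eq_sym.
rewrite -IH //.
  by rewrite tperm_prod_cons /= -mulgA cat_rcons.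
rewrite (perm_uniq (_ : perm_eq _ (flatten (acc ++ (a :: flatten (u :: us)) :: rest)))) //.
apply/seq.permP => p; rewrite !flatten_cat flatten_rcons /= !count_cat /= !count_cat; lia.
Qed.

Lemma forests_prod (T : finType) (s : seq T) (x : seq (seq T) * seq (T * T)) :
  uniq s -> x \in forests s -> tperm_prod x.2 = tperm_prod (stars x.1).
Proof.
move=> + xs; elim/forests_ind: s x / xs => // a s x r xs IH rx /= /andP[aN U].
rewrite tperm_prod_cat IH //.
have E := cat_take_drop r x.1; rewrite -{2}E.
apply: (@root_edges_prod _ a [::]) => /=.
  by apply: contra (forests_nonempty xs) => /mem_take.
by rewrite -flatten_cat E (forests_flatten xs) aN.
Qed.

(* If a and b were in different cycles, multiplying by (a b) would lower the
   number of cycles below what the remaining transpositions allow. *)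
Lemma stars_first_edge (T : finType) (a b : T) t acc y rest :
  uniq (flatten (acc ++ (a :: y) :: rest)) -> a != b ->
  tperm_prod ((a, b) :: t) = tperm_prod (stars (acc ++ (a :: y) :: rest)) ->
  (size t).+1 = size (stars (acc ++ (a :: y) :: rest)) -> b \in y.
Proof.
move=> U ab E Sz; have PS := porbits_stars U.
have := porbits_prod_ge t.
rewrite tperm_prod_cons /= in E.
have -> : tperm_prod t = (tperm a b * tperm_prod (stars (acc ++ (a :: y) :: rest)))%g.
  by rewrite -E mulgA tperm2 mul1g.
have /= := porbits_mul_tperm (tperm_prod (stars (acc ++ (a :: y) :: rest))) a b.
rewrite ab; set s := tperm_prod (stars _) in E PS *.
case: (boolP (a \in porbit s b)) => [/porbitP[i ai] _ _|_ /=]; last first.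
  by move: PS Sz; set N := #|porbits s|; set M := #|porbits _|; set C := #|T|; lia.
(* Now [a] and [b] share a cycle of [s]. Every edge has both or none of its ends in [a :: y], so
   this set is stable and contains [b]. *)
suff H x : (s x \in a :: y) = (x \in a :: y).
  have : (s ^+ i)%g b \in a :: y by rewrite -ai mem_head.
  have -> : ((s ^+ i)%g b \in a :: y) = (b \in a :: y).
    by elim: i {ai} => [|i IH]; rewrite ?expg0 ?perm1 // expgSr permM H.
  by rewrite inE eq_sym (negPf ab).
apply: (@tperm_prod_stable _ (mem (a :: y))) => -[p q].
rewrite stars_cat stars_cons !mem_cat => H.
move: U; rewrite flatten_cat [flatten (_ :: _)]/= -cat_cons uniq_catCA cat_uniq.
move=> /and3P[_ /hasPn D _].
have Dn z : z \in flatten acc ++ flatten rest -> (z \in a :: y) = false by move/D/negPf.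
case/or3P: H => [/stars_sub[]|/star_sub[/= -> ->] //|/stars_sub[]] /= pf qf.
  by rewrite !Dn // mem_cat ?pf ?qf.
by rewrite !Dn // mem_cat ?pf ?qf orbT.
Qed.

(** Converse of [root_edges_prod]. The size condition says that the factorisation is minimal, so by
    [stars_first_edge] each edge (a, b) of [t1] cuts off the initial segment of [y] that ends in
    [b]; these segments form [us]. *)
Lemma stars_strip_root (T : finType) (a : T) t1 t2 acc y rest :
  uniq (flatten (acc ++ (a :: y) :: rest)) ->
  {in t1, forall p, p.1 = a /\ p.2 != a} -> {in t2, forall p, p.1 != a /\ p.2 != a} ->
  tperm_prod (t1 ++ t2) = tperm_prod (stars (acc ++ (a :: y) :: rest)) ->
  size (t1 ++ t2) = size (stars (acc ++ (a :: y) :: rest)) ->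
  exists us, [/\ y = flatten us, [::] \notin us, t1 = root_edges a us &
                 tperm_prod t2 = tperm_prod (stars (acc ++ us ++ rest))].
Proof.
elim: t1 acc y => [|[a' b] t1 IH] acc y U H1 H2 E Sz.
  exists [::]; suff y0 : y = [::] by rewrite y0 in E *; split=> //; rewrite E !stars_cat.
  (* Without further edges at [a] the product fixes [a], whereas the star on [a :: b :: y] would
     send it to [b]. *)
  have : tperm_prod t2 a = a by apply: tperm_prod_fix.
  rewrite E stars_cat stars_cons !tperm_prod_cat !permM.
  move: U; rewrite flatten_cat [flatten (_ :: _)]/= -cat_cons uniq_catCA cat_uniq.
  move=> /and3P[U1 /hasPn D _].
  have Df x : x \in a :: y -> x \notin flatten acc /\ x \notin flatten rest.
    move=> xy; split; apply/negP => xf.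
      by have := D x; rewrite mem_cat xf => /(_ isT); rewrite /= xy.
    by have := D x; rewrite mem_cat xf orbT => /(_ isT); rewrite /= xy.
  rewrite (@stars_fix _ acc); last by case: (Df a (mem_head _ _)).
  case: y U1 Df {D E Sz} => // b y U1 Df.
  rewrite [star _]/= tperm_prod_cons permM tpermL /=.
  move: U1; rewrite /= inE negb_or -andbA => /and4P[ab aN bN _].
  rewrite (@star_fix _ (a :: y)); last by rewrite inE negb_or eq_sym ab.
  rewrite stars_fix; last by case: (Df b) => //; rewrite !inE eqxx orbT.
  by move=> ba; rewrite ba eqxx in ab.
have [/= aa ba] := H1 (a', b) (mem_head _ _); subst a'.
have ab : a != b by rewrite eq_sym.
have yb := stars_first_edge U ab E Sz.
(* The segment of [y] up to and including [b] is the subtree of the first child. *)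
case/path.splitP: yb U E Sz => u y' U E Sz.
have u0 : rcons u b != [::] by case: (u).
have [|||||us [yE us0 t1E t2E]] := IH (rcons acc (rcons u b)) y'.
- rewrite (perm_uniq (_ : perm_eq _ (flatten (acc ++ (a :: rcons u b ++ y') :: rest)))) //.
  apply/seq.permP => p; rewrite !flatten_cat flatten_rcons /= !count_cat /= !count_cat; lia.
- by move=> p pt; apply: H1; rewrite inE pt orbT.
- by [].
- rewrite -(stars_cut u0 U) /= last_rcons in E.
  by move: E; rewrite tperm_prod_cons => /mulgI.
- have Su : size (star (rcons u b)) = size u.
    by case: (u) => //= c v; rewrite size_map size_rcons.
  move: Sz; rewrite -(cats1 acc) -catA !stars_cat !stars_cons !size_cat Su /=.
  by rewrite !size_map !size_cat size_rcons; lia.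
exists (rcons u b :: us); split.
- by rewrite /= -yE.
- by rewrite inE negb_or eq_sym u0.
- by rewrite /root_edges /= last_rcons -/(root_edges a us) -t1E.
- by rewrite t2E cat_rcons.
Qed.

Lemma size_stars (T : eqType) (L : seq (seq T)) : [::] \notin L ->
  size (stars L) + size L = size (flatten L).
Proof.
elim: L => // u L IH; rewrite inE negb_or => /andP[u0 /IH].
by rewrite stars_cons /= !size_cat => <-; case: u u0 => // a v _; rewrite /= size_map; lia.
Qed.

Definition edge_le n (p q : 'I_n * 'I_n) : bool := p.1 <= q.1.

Lemma edge_le_trans n : transitive (@edge_le n).
Proof. by move=> p q r; apply: leq_trans. Qed.

Lemma filter_nil (T : Type) (P : pred T) (t : seq T) :
  ~~ has P t -> [seq p <- t | P p] = [::].
Proof. by move=> H; apply/nilP; rewrite /nilp size_filter -leqn0 leqNgt -has_count. Qed.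

Lemma sorted_min_split n (a : 'I_n) (t : seq ('I_n * 'I_n)) :
  sorted (@edge_le n) t -> {in t, forall p : 'I_n * 'I_n, a <= p.1} ->
  t = [seq p <- t | p.1 == a] ++ [seq p <- t | p.1 != a].
Proof.
elim: t => // p t IH /= pt H.
have {}IH : t = [seq p0 <- t | p0.1 == a] ++ [seq p0 <- t | p0.1 != a].
  by apply: IH; [apply: path_sorted pt | move=> q qt; apply: H; rewrite inE qt orbT].
case: eqP => /= [_|pa]; first by congr (_ :: _).
suff E : [seq p0 <- t | p0.1 == a] = [::] by rewrite E; congr (_ :: _); rewrite E in IH.
apply: filter_nil; apply/hasPn => q qt; apply/eqP => qa.
have /allP/(_ _ qt) := order_path_min (@edge_le_trans n) pt.
rewrite /edge_le qa => pa'; apply: pa; apply/val_inj/eqP; rewrite eqn_leq pa' /=.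
by apply: H; rewrite mem_head.
Qed.

Lemma forests_add_root (T : eqType) (a : T) s (x : seq (seq T) * seq (T * T)) r :
  x \in forests s -> r <= size x.1 -> add_root a x r \in forests (a :: s).
Proof.
move=> xs rx; apply/allpairsPdep; exists x, r; split=> //.
by rewrite mem_iota ltnS.
Qed.

(** Induction on the smallest label [a]. It heads the first cycle, and its edges come first in [t];
    stripping them replaces that cycle by the cycles of the children of [a], which leaves the same
    situation on the remaining labels. *)
Lemma forests_complete n (s : seq 'I_n) (L : seq (seq 'I_n)) (t : seq ('I_n * 'I_n)) :
  sorted (fun i j : 'I_n => i < j) s -> flatten L = s -> [::] \notin L ->
  {in t, forall p : 'I_n * 'I_n, (p.1 < p.2) && (p.1 \in s)} -> sorted (@edge_le n) t ->
  tperm_prod t = tperm_prod (stars L) -> size t + size L = size s ->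
  (L, t) \in forests s.
Proof.
elim: s L t => [|a s IH] L t Hs LE L0 Ht St E Sz.
  case: L LE L0 Sz {E} => [_ _|u L /= LE]; last first.
    by case: u LE => //= _; rewrite inE eqxx.
  by case: t {Ht St}; rewrite //= inE.
case: L LE L0 E Sz => [//|[|a' y] rest]; first by rewrite inE eqxx.
rewrite [flatten _]/= inE negb_or /= => -[-> ysE] rest0 E Sz.
have tr : transitive (fun i j : 'I_n => i < j) by move=> i j k; apply: ltn_trans.
have /allP as_ := order_path_min tr Hs.
have aN : a \notin s by apply/negP => /as_; rewrite ltnn.
have Us : uniq (flatten ([::] ++ (a :: y) :: rest)).
  by rewrite /= ysE; exact: (sorted_uniq tr (fun i => ltnn i) Hs).
have tE : t = [seq p <- t | p.1 == a] ++ [seq p <- t | p.1 != a].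
  apply: sorted_min_split => // p /Ht /andP[_]; rewrite inE => /orP[/eqP -> //|/as_].
  exact: ltnW.
have [||||us [yE us0 t1E t2E]] := @stars_strip_root _ a [seq p <- t | p.1 == a]
  [seq p <- t | p.1 != a] [::] y rest Us.
- move=> p; rewrite mem_filter => /andP[/eqP pa /Ht /andP[pp _]]; split=> //.
  by apply: contraTneq pp => ->; rewrite pa ltnn.
- move=> p; rewrite mem_filter => /andP[pa /Ht /andP[pp]]; rewrite inE (negPf pa) /= => ps.
  by split=> //; apply: contraTneq (as_ _ ps) => <-; rewrite -leqNgt ltnW.
- by rewrite -tE.
- rewrite -tE; have := @size_stars _ ((a :: y) :: rest).
  rewrite inE negb_or rest0 => /(_ isT) H.
  by move: Sz; rewrite /= in H *; rewrite -ysE; lia.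
have H2 : (us ++ rest, [seq p <- t | p.1 != a]) \in forests s.
  apply: IH.
  - exact: path_sorted Hs.
  - by rewrite flatten_cat -yE.
  - by rewrite mem_cat negb_or us0.
  - move=> p; rewrite mem_filter => /andP[pa /Ht /andP[->]].
    by rewrite inE (negPf pa).
  - by apply: sorted_filter St; apply: edge_le_trans.
  - by rewrite t2E.
  - move: Sz; rewrite {1}tE size_cat t1E size_map size_cat /=; lia.
(* The number of trees to put back below [a] is [r = size us]. *)
have := forests_add_root a H2 (_ : size us <= size (us ++ rest)).
rewrite /add_root /= take_size_cat // drop_size_cat // -yE -t1E -tE; apply.
by rewrite size_cat leq_addr.
Qed.

Lemma forests_edge_lt n (s : seq 'I_n) (x : seq (seq 'I_n) * seq ('I_n * 'I_n)) p :
  sorted (fun i j : 'I_n => i < j) s -> x \in forests s -> p \in x.2 -> p.1 < p.2.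
Proof.
move=> + xs; elim/forests_ind: s x / xs => // a s x r xs IH rx /= Hs.
rewrite mem_cat => /orP[px|]; last by apply: IH; apply: path_sorted Hs.
have tr : transitive (fun i j : 'I_n => i < j) by move=> i j k; apply: ltn_trans.
have /allP as_ := order_path_min tr Hs.
case/mapP: px => u ux -> /=.
apply: as_; rewrite -(forests_flatten xs).
case: u ux => [|b v] ux; first by case/negP: (forests_nonempty xs); apply: mem_take ux.
by apply/flattenP; exists (b :: v); [exact: mem_take ux | rewrite /= mem_last].
Qed.

Lemma forests_sorted n (s : seq 'I_n) (x : seq (seq 'I_n) * seq ('I_n * 'I_n)) :
  sorted (fun i j : 'I_n => i < j) s -> x \in forests s -> sorted (@edge_le n) x.2.
Proof.
move=> + xs; elim/forests_ind: s x / xs => // a s x r xs IH rx /= Hs.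
have tr : transitive (fun i j : 'I_n => i < j) by move=> i j k; apply: ltn_trans.
have /allP as_ := order_path_min tr Hs.
rewrite sorted_pairwise; last exact: edge_le_trans.
rewrite pairwise_cat -[in pairwise _ x.2]sorted_pairwise; last exact: edge_le_trans.
rewrite IH ?(path_sorted Hs) // andbT; apply/andP; split.
  apply/allrelP => _ q /mapP[u _ ->] /(forests_mem xs)[qs _].
  by rewrite /edge_le /= ltnW // as_.
rewrite /root_edges; elim: (take r x.1) => //= u us ->; rewrite andbT.
by apply/allP => _ /mapP[v _ ->]; rewrite /edge_le /=.
Qed.

(** * Leaves, inner nodes and uniqueness of the forest *)

Lemma last_flatten (T : eqType) (a : T) us : [::] \notin us ->
  last a (flatten us) = last a [seq last a u | u <- us].
Proof.
case/lastP: us => // us u; rewrite mem_rcons inE negb_or => /andP[u0 _].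
rewrite flatten_rcons last_cat map_rcons last_rcons.
by case: u u0.
Qed.

(** The last node of a tree with several nodes is the last descendant of the last child of its
    root. *)
Lemma forests_last_upper (T : eqType) (s : seq T) (x : seq (seq T) * seq (T * T)) a u :
  x \in forests s -> a :: u \in x.1 -> u != [::] -> last a u \in unzip2 x.2.
Proof.
move=> xs; elim/forests_ind: s x / xs a u => // b s x r xs IH rx a u.
rewrite /add_root /= inE /unzip2 map_cat mem_cat => /orP[/eqP[-> ->]|/mem_drop ux u0].
  have t0 : [::] \notin take r x.1.
    by apply: contra (forests_nonempty xs) => /mem_take.
  rewrite last_flatten // /root_edges -map_comp => f0.
  apply/orP; left.
  rewrite (_ : [seq (snd \o _) i | i <- _] = [seq last b u | u <- take r x.1]) //.
  by case: (take r x.1) f0 => // c l _; rewrite /= mem_last.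
by rewrite IH ?orbT.
Qed.

(** Upper ends and last nodes of trees are leaves. Conversely a leaf is an upper end, unless it is a
    one-node tree and so the last node of that tree. Excluding the last nodes of all trees makes the
    statement inductive, since these become upper ends once their trees get a parent. *)
Lemma forests_lowerE (T : eqType) (s : seq T) (x : seq (seq T) * seq (T * T)) c :
  uniq s -> x \in forests s -> c \in s ->
  (c \in unzip1 x.2) = (c \notin unzip2 x.2) && (c \notin [seq last c u | u <- x.1]).
Proof.
move=> + xs; elim/forests_ind: s x / xs => // a s x r xs IH rx /= /andP[aN U] cs.
have t0 : [::] \notin take r x.1.
  by apply: contra (forests_nonempty xs) => /mem_take.
have ls u : u \in x.1 -> forall b, last b u \in s.
  move=> ux b; rewrite -(forests_flatten xs).
  case: u ux => [|d v] ux; first by case/negP: (forests_nonempty xs).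
  by apply/flattenP; exists (d :: v); [exact: ux | rewrite /= mem_last].
rewrite inE /unzip1 /unzip2 !map_cat !mem_cat /root_edges -!map_comp /=.
rewrite (_ : [seq (snd \o _) i | i <- _] = [seq last a u | u <- take r x.1]) //.
rewrite last_flatten //.
have [ca|ca] := eqVneq c a.
  subst c.
  have -> : (a \in [seq i.1 | i <- x.2]) = false.
    by apply/negP => /mapP[p /(forests_mem xs)[ps _] ap]; rewrite ap ps in aN.
  have -> : (a \in [seq i.2 | i <- x.2]) = false.
    by apply/negP => /mapP[p /(forests_mem xs)[_ ps] ap]; rewrite ap ps in aN.
  have H us : {subset us <= x.1} -> (a \in [seq last a u | u <- us]) = false.
    move=> sub; apply/negP => /mapP[u /sub /ls ux E].
    by move: aN; rewrite {1}E ux.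
  rewrite !H; last 2 first.
  - by move=> u /mem_drop.
  - by move=> u /mem_take.
  (* Without a child [a] is the last node of its own tree; with one it is an inner node. *)
  case E: (take r x.1) => [|u us] /=; first by rewrite eqxx.
  rewrite mem_head /= orbF; symmetry.
  apply: contraFneq (H (u :: us) _) => [E1|]; first by rewrite {1}E1 /= mem_last.
  by rewrite -E => v /mem_take.
move: cs; rewrite inE (negPf ca) /= => cs.
have -> : (c \in [seq (fst \o (fun u => (a, last a u))) i | i <- take r x.1]) = false.
  by apply/negP => /mapP[u _ /= ca']; rewrite ca' eqxx in ca.
have Ex : [seq last c u | u <- x.1] =
    [seq last c u | u <- take r x.1] ++ [seq last c u | u <- drop r x.1].
  by rewrite -map_cat cat_take_drop.
rewrite /= IH // Ex mem_cat !negb_or.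
have -> : [seq last c u | u <- take r x.1] = [seq last a u | u <- take r x.1].
  by apply/eq_in_map => -[|d v] // ux; case/negP: t0.
(* The new tree ends in [a] or in the last node of a tree joined to it, so no other node changes its
   status. *)
have : last a [seq last a u | u <- take r x.1] \in a :: [seq last a u | u <- take r x.1].
  exact: mem_last.
move: (last a _) => l; rewrite inE.
have [->|_] := eqVneq l a; first by rewrite (negPf ca) /=; do ! case: (c \in _).
move=> /= lin; have [->|_] := eqVneq c l; first by rewrite lin /= !andbF.
by do ! case: (c \in _).
Qed.

(** In a list without repetitions the position of the last entry of a block determines the length of
    the block. *)
Lemma flatten_last_inj (T : eqType) (c : T) (us vs : seq (seq T)) :
  uniq (flatten us) -> [::] \notin us -> [::] \notin vs -> flatten us = flatten vs ->
  [seq last c u | u <- us] = [seq last c u | u <- vs] -> us = vs.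
Proof.
elim: us vs => [|u us IH] [|v vs] //= U; rewrite !inE !negb_or.
move=> /andP[u0 us0] /andP[v0 vs0] E [El Es].
have [uv EE] : u = v /\ flatten us = flatten vs.
  suff Sz : size u = size v.
    by move/eqP: E; rewrite eqseq_cat // => /andP[/eqP -> /eqP ->].
  have pos (w : seq T) F : [::] != w -> uniq (w ++ F) ->
      index (last c w) (w ++ F) = (size w).-1.
    case/lastP: w => // w b _ Uw; rewrite last_rcons size_rcons /= index_cat mem_rcons mem_head.
    move: Uw; rewrite cat_uniq rcons_uniq => /and3P[/andP[bw _] _ _].
    by rewrite -cats1 index_cat (negPf bw) /= eqxx addn0.
  have Pu := pos u _ u0 U; have Pv := pos v (flatten vs) v0.
  rewrite -E in Pv; have := Pv U; rewrite -El Pu.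
  by case: (u) u0 => // ? ? _; case: (v) v0 => // ? ? _ /= ->.
by rewrite -uv; congr (_ :: _); apply: IH => //; move: U; rewrite cat_uniq => /and3P[].
Qed.

(** The step can be undone: the edges at [a] give the last nodes of its children, hence by
    [flatten_last_inj] the children and [r]; the other edges belong to the smaller forest. *)
Lemma forests_uniq (T : eqType) (s : seq T) : uniq s -> uniq (forests s).
Proof.
elim: s => // a s IH; rewrite cons_uniq => /andP[aN U].
apply: allpairs_uniq_dep; [exact: IH | by move=> x _; apply: iota_uniq|].
have ind (z : {_ : seq (seq T) * seq (T * T) & nat}) :
    z \in [seq existT (fun=> nat) x r | x <- forests s, r <- iota 0 (size x.1).+1] ->
    (tag z \in forests s) /\ (tagged z <= size (tag z).1).
  move=> /allpairsPdep[x [r [xs rs ->]]] /=; split=> //.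
  by move: rs; rewrite mem_iota ltnS.
move=> [x r] [x' r'] /ind /= [xs rx] /ind /= [xs' rx'] [Ef Ed Ee].
have no y : y \in forests s -> [seq p <- y.2 | p.1 == a] = [::] /\ [seq p <- y.2 | p.1 != a] = y.2.
  move=> ys.
  have H : {in y.2, forall p, (p.1 == a) = false}.
    by move=> p py; apply: contraNF aN => /eqP <-; case: (forests_mem ys py).
  split.
    by rewrite (eq_in_filter H) filter_pred0.
  by apply/all_filterP/allP => p /H ->.
have re us : [seq p <- root_edges a us | p.1 == a] = root_edges a us /\
             [seq p <- root_edges a us | p.1 != a] = [::].
  by elim: us => //= u us [-> ->]; rewrite eqxx.
have E2 : x.2 = x'.2.
  have := congr1 (seq.filter (fun p => p.1 != a)) Ee.
  by rewrite !filter_cat !(proj2 (re _)) !(proj2 (no _ _)).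
have E1 : root_edges a (take r x.1) = root_edges a (take r' x'.1).
  have := congr1 (seq.filter (fun p => p.1 == a)) Ee.
  by rewrite !filter_cat !(proj1 (re _)) !(proj1 (no _ _)) // !cats0.
have t0 y k : y \in forests s -> [::] \notin take k y.1.
  by move=> /forests_nonempty; apply: contra => /mem_take.
have Et : take r x.1 = take r' x'.1.
  apply: (@flatten_last_inj _ a) => //; try exact: t0.
    move: U; rewrite -(forests_flatten xs) -{1}(cat_take_drop r x.1) flatten_cat cat_uniq.
    by case/and3P.
  by have := congr1 (map snd) E1; rewrite /root_edges -!map_comp.
have Er : r = r' by have := congr1 size Et; rewrite !size_takel.
have Ex : x.1 = x'.1 by rewrite -(cat_take_drop r x.1) Et Ed cat_take_drop.
by case: x x' Ex E2 {xs xs' rx rx' Ef Ed Ee E1 Et} => x1 x2 [x1' x2'] /= -> ->; rewrite Er.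
Qed.

Definition lower_count (T : eqType) (t : seq (T * T)) : nat := size (undup (unzip1 t)).

(* (number of trees, number of inner nodes) of each forest with j nodes *)
Fixpoint forest_shapes (j : nat) : seq (nat * nat) :=
  if j is j'.+1 then
    [seq ((y.1 - r).+1, (0 < r) + y.2) | y <- forest_shapes j', r <- iota 0 y.1.+1]
  else [:: (0, 0)].

Lemma forests_shapes (T : eqType) (s : seq T) : uniq s ->
  [seq (size x.1, lower_count x.2) | x <- forests s] = forest_shapes (size s).
Proof.
elim: s => // a s IH; rewrite cons_uniq => /andP[aN U].
rewrite (_ : forest_shapes (size (a :: s)) = [seq ((y.1 - r).+1, (0 < r) + y.2) |
  y <- forest_shapes (size s), r <- iota 0 y.1.+1]) // -IH // allpairs_mapl map_allpairs.
apply/eq_in_allpairs_dep => x xs r; rewrite mem_iota /= ltnS => rx.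
rewrite size_drop; congr (_, _).
rewrite /lower_count /unzip1 map_cat /root_edges -map_comp /=.
have aN2 : a \notin [seq i.1 | i <- x.2].
  by apply/mapP => -[p /(forests_mem xs)[ps _] ap]; rewrite ap ps in aN.
have -> : [seq (fst \o (fun u : seq T => (a, last a u))) i | i <- take r x.1] = nseq r a.
  by rewrite -{2}(size_takel rx); elim: (take r x.1) => //= u us ->.
case: r {rx} => // r; rewrite add1n /=.
elim: r => [|r IHr] /=; first by rewrite (negPf aN2).
by rewrite inE eqxx.
Qed.

(** * Narayana numbers *)

(** Counting forests with at least [q] trees, instead of exactly [q], gives a recurrence with a
    bounded number of terms. *)
Definition shape_count (j q k : nat) : nat :=
  count (fun y : nat * nat => (q <= y.1) && (y.2 == k)) (forest_shapes j).

Lemma shapes_bound j y : y \in forest_shapes j -> y.1 <= j /\ (0 < j -> 0 < y.1).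
Proof.
elim: j y => [|j IH] y; first by rewrite inE => /eqP ->.
case/allpairsPdep => y' [r [/IH[yj _] _ ->]] /=; split=> //.
by rewrite ltnS (leq_trans (leq_subr _ _)).
Qed.

Lemma count_iota_le m p : count (fun r => r <= m) (iota 1 p) = minn m p.
Proof.
elim: p => [|p IH]; first by rewrite minn0.
by rewrite -(addn1 p) iotaD count_cat IH /= add1n; case: leqP; lia.
Qed.

Lemma shape_step p l q k : 0 < q ->
  count (fun r => (q <= (p - r).+1) && ((0 < r) + l == k)) (iota 0 p.+1)
    + ((q <= p) && (l == k))
  = count (fun r => (q.+1 <= (p - r).+1) && ((0 < r) + l == k)) (iota 0 p.+1)
    + ((q.-1 <= p) && (l == k)) + ((q <= p) && (l.+1 == k)).
Proof.
move=> q0.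
(* There is one choice with [r = 0], and there are [p.+1 - q'] choices with [r > 0], none if [q']
   exceeds [p]. *)
have H q' : 0 < q' ->
    count (fun r => (q' <= (p - r).+1) && ((0 < r) + l == k)) (iota 0 p.+1)
    = ((q' <= p.+1) && (l == k)) + (p.+1 - q') * (l.+1 == k).
  move=> q'0; rewrite /= subn0 add0n; congr addn.
  case: (eqVneq l.+1 k) => [E|E]; rewrite /= ?muln1 ?muln0.
    transitivity (minn (p.+1 - q') p); last by apply/minn_idPl; move: q'0; clear; lia.
    rewrite -count_iota_le; apply: eq_in_count => r; rewrite mem_iota => rb.
    by rewrite (_ : 0 < r) ?E ?eqxx ?andbT; lia.
  transitivity (count pred0 (iota 1 p)); last exact: count_pred0.
  apply: eq_in_count => r; rewrite mem_iota => rb.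
  rewrite (_ : 0 < r); last by lia.
  by rewrite add1n (negPf E) andbF.
rewrite !H //.
by case: (l == k); case: (l.+1 == k); rewrite ?andbT ?andbF; lia.
Qed.

(** Exactly [q] trees on [j.+1] nodes arise from [q.-1] trees by adding an isolated root, or from p
    trees with p at least [q] by joining p + 1 - q of them under a new inner node. *)
Lemma shape_countS j q k : 0 < q ->
  shape_count j.+1 q k + shape_count j q k =
  shape_count j.+1 q.+1 k + shape_count j q.-1 k +
    (if k is k'.+1 then shape_count j q k' else 0).
Proof.
move=> q0.
have E q' : shape_count j.+1 q' k = \sum_(y <- forest_shapes j)
    count (fun r => (q' <= (y.1 - r).+1) && ((0 < r) + y.2 == k)) (iota 0 y.1.+1).
  rewrite /shape_count [forest_shapes _]/forest_shapes -/forest_shapes.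
  rewrite count_flatten -map_comp sumnE big_map; apply: eq_bigr => y _.
  by rewrite /= count_map; congr addn; rewrite count_map.
have C (P : pred (nat * nat)) : count P (forest_shapes j) = \sum_(y <- forest_shapes j) P y.
  by rewrite -sum1_count big_mkcond; apply: eq_bigr => y _; case: (P y).
rewrite !E.
have -> : (if k is k'.+1 then shape_count j q k' else 0) =
   \sum_(y <- forest_shapes j) ((q <= y.1) && (y.2.+1 == k)).
  case: k {E} => [|k]; last by rewrite /shape_count C.
  by rewrite big1 // => y _; rewrite andbF.
rewrite /shape_count !C -!big_split; apply: eq_bigr => y _.
exact: shape_step.
Qed.

Lemma shape_count_size0 j k : shape_count j.+1 0 k = shape_count j.+1 1 k.
Proof.
by apply: eq_in_count => y /shapes_bound[_ /(_ isT) ->].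
Qed.

Lemma shape_count_gt j q k : j < q -> shape_count j q k = 0.
Proof.
move=> jq; transitivity (count pred0 (forest_shapes j)); last exact: count_pred0.
by apply: eq_in_count => y /shapes_bound[yj _]; rewrite leqNgt (leq_ltn_trans yj jq).
Qed.

(* The 2x2 determinant of the reflection principle, its negative term moved to the
   left-hand side so that no truncated subtraction occurs. *)
Lemma shape_countE j i k : i <= j.+1 ->
  shape_count j.+1 (j.+1 - i) k
    + (if k is k'.+1 then 'C(j, k') * 'C(i, k'.+2) else 0)
  = 'C(j, k) * 'C(i, k).
Proof.
elim: j i k => [|j IHj] i k.
  rewrite /shape_count /= subn0.
  by case: i => [|[|//]] _; case: k => [|[|k]] //; rewrite !binS !bin0n.
elim: i => [|i IHi] ij.
  have := shape_countS j.+1 k (ltn0Sn j.+1).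
  rewrite subn0 (@shape_count_gt j.+1 j.+2) // (@shape_count_gt j.+2 j.+3) //=.
  have := IHj 0 k isT; rewrite subn0.
  case: k => [|k]; rewrite ?bin0 ?bin0n /= ?muln0; first lia.
  by rewrite (@shape_count_gt j.+1 j.+2) //; lia.
case: (ltngtP i j.+1) ij => [ij _|ij|ie]; last 2 first.
- by rewrite ltnS leqNgt ij.
(* Here the number of trees is at least 0, which for a nonempty forest is the same as at least 1. *)
- move: IHi; rewrite ie => IHi _; rewrite subnn shape_count_size0.
  move: (IHi (leqnSn _)); rewrite subSn // subnn => {IHi}.
  by case: k => [|k]; rewrite ?bin0 // !binS; lia.
have q0 : 0 < j.+2 - i.+1 by lia.
have := shape_countS j.+1 k q0.
rewrite (_ : (j.+2 - i.+1).+1 = j.+2 - i); last by lia.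
rewrite (_ : (j.+2 - i.+1).-1 = j.+1 - i.+1); last by lia.
rewrite (_ : j.+2 - i.+1 = j.+1 - i); last by lia.
move: (IHi (ltnW (leqW ij))) (IHj i.+1 k ij) (IHj i k (ltnW ij)) => {IHi}.
case: k => [|k]; first by rewrite !bin0; lia.
have := IHj i k (ltnW ij).
by case: k => [|k]; rewrite ?bin0 !binS ?bin0; lia.
Qed.

Definition narayana_count (n k : nat) : nat :=
  count (fun y : nat * nat => (y.1 == 1) && (y.2 == k)) (forest_shapes n).

(** Removing the root of a tree with [j.+2] nodes and [k.+1] inner nodes leaves an arbitrary forest
    with [j.+1] nodes and [k] inner nodes. So the count is C(j,k)^2 - C(j,k-1) C(j,k+1), and the
    factor [m] avoids a division. *)
Lemma narayana_countE m k : 0 < m -> 0 < k ->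
  m * narayana_count m.+1 k = 'C(m, k) * 'C(m, k.-1).
Proof.
case: m k => // j [//|k] _ _ /=.
have E : narayana_count j.+2 k.+1 = shape_count j.+1 1 k.
  have := shape_countS j.+1 k.+1 (ltn0Sn 0); rewrite /= shape_count_size0.
  have : shape_count j.+2 1 k.+1 = narayana_count j.+2 k.+1 + shape_count j.+2 2 k.+1.
    rewrite /shape_count /narayana_count -count_predUI.
    rewrite [X in _ + X](_ : _ = 0).
      rewrite addn0; apply: eq_count => -[[|[|p]] l] //=; by rewrite ?orbF.
    transitivity (count pred0 (forest_shapes j.+2)); last exact: count_pred0.
    by apply: eq_count => -[[|[|p]] l] //=; rewrite andbF.
  lia.
have := @shape_countE j j k (leqnSn _); rewrite subSn // subnn -E.
move: (narayana_count _ _) => N; rewrite !binS.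
have := mul_bin_left j k.
case: k {E} => [|k].
  by rewrite !bin0 bin1; nia.
rewrite !binS; have := mul_bin_left j k.
case: (ltnP k j) => kj; last first.
  by rewrite (_ : j - k.+1 = 0) ?(@bin_small j k.+1) ?(@bin_small j k.+2); lia.
rewrite (_ : j - k = (j - k.+1).+1); last by lia.
have jE : j = k.+1 + (j - k.+1) by lia.
move: (j - k.+1) jE 'C(j, k) 'C(j, k.+1) 'C(j, k.+2) => b -> x y z.
move=> /= xy yz Nx.
(* With these multiples of the relations between consecutive binomials the goal is linear in the
   monomials that occur. *)
have := congr1 (muln y) xy; have := congr1 (muln z) xy.
have := congr1 (muln x) yz; have := congr1 (muln y) yz.
have := congr1 (muln (k.+1 + b).+1) Nx.
lia.
Qed.

(** * Factorisations of the long cycle *)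

Lemma star_nth (T : finType) (x0 a : T) v i : uniq (a :: v) -> i < size v ->
  tperm_prod (star (a :: v)) (nth x0 (a :: v) i) = nth x0 (a :: v) i.+1.
Proof.
elim: v i => // b v IH i; rewrite cons_uniq inE negb_or -andbA.
case/and3P=> ab av /=/andP[bv U] iv.
have Hb : tperm_prod [seq (a, b) | b <- v] b = b.
  by apply: (@star_fix _ (a :: v)); rewrite inE negb_or eq_sym ab.
rewrite tperm_prod_cons permM /=.
case: i iv => [|i] iv /=; first by rewrite tpermL Hb.
have Ua : uniq (a :: v) by rewrite /= av.
case: i iv => [|i] iv /=; first by rewrite tpermR (IH 0).
have iv' : i < size v by exact: ltnW.
rewrite tpermD ?(IH i.+1) //; first by apply: contraNneq av => ->; rewrite mem_nth.
by apply: contraNneq bv => ->; rewrite mem_nth.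
Qed.

Lemma star_enum n : tperm_prod (star (enum 'I_n)) = long_cycle n.
Proof.
apply/permP => x; rewrite permE.
have n0 : 0 < n by case: n x => // -[].
have Sz := size_enum_ord n; have U := enum_uniq 'I_n.
have Nx (y : 'I_n) : nth x (enum 'I_n) y = y by rewrite nth_ord_enum.
case E : (enum 'I_n) Sz U Nx => [|a v] Sz U Nx; first by rewrite -Sz in n0.
rewrite -{1}(Nx x).
have : x < size (a :: v) by rewrite Sz.
rewrite /= ltnS leq_eqVlt; case/orP => [/eqP xv|xv].
  rewrite xv -[size v]/(size (a :: v)).-1 nth_last star_last // -(Nx (ordS x)) /=.
  by rewrite xv -[(size v).+1]/(size (a :: v)) Sz modnn.
rewrite (star_nth _ U xv) -[RHS](Nx (ordS x)) /=.
by rewrite modn_small // -[X in _ < X]Sz /= ltnS.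
Qed.

Definition edge_perm n (p : 'I_n * 'I_n) : 'S_n := tperm p.1 p.2.

Lemma transposition_ends_edge n (p : 'I_n * 'I_n) a b : p.1 < p.2 ->
  transposition_ends (edge_perm p) a b = ((a, b) == p).
Proof.
case: p => p q /= pq; apply/andP/eqP => [[ab /eqP E]|[-> ->]]; last by [].
have : tperm p q a = b by move: E; rewrite /edge_perm /= => ->; rewrite tpermL.
case: tpermP => [-> -> //|aq pb|_ _ ba].
  by move: pq; rewrite -aq pb ltnNge ltnW.
by move: ab; rewrite ba ltnn.
Qed.

Lemma tnth_edge n (x0 : 'I_n * 'I_n) (t : n.-1.-tuple 'S_n) l (i : 'I_n.-1) :
  tval t = map (@edge_perm n) l -> tnth t i = edge_perm (nth x0 l i).
Proof.
move=> tE; have Sl : size l = n.-1 by rewrite -(size_tuple t) tE size_map.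
by rewrite (tnth_nth (edge_perm x0)) tE (nth_map x0) // Sl.
Qed.

Lemma edge_perm_inj n (l1 l2 : seq ('I_n * 'I_n)) :
  {in l1, forall p : 'I_n * 'I_n, p.1 < p.2} ->
  {in l2, forall p : 'I_n * 'I_n, p.1 < p.2} ->
  map (@edge_perm n) l1 = map (@edge_perm n) l2 -> l1 = l2.
Proof.
elim: l1 l2 => [|p l1 IH] [|q l2] //= H1 H2 [pq E].
congr (_ :: _); last first.
  by apply: IH => // r rl; [apply: H1 | apply: H2]; rewrite inE rl orbT.
have := transposition_ends_edge p.1 p.2 (H2 q (mem_head _ _)).
rewrite -pq transposition_ends_edge; last by apply: H1; apply: mem_head.
by rewrite -surjective_pairing eqxx => /esym/eqP.
Qed.

Lemma transpositions_edges n (t : seq 'S_n) : all (@is_transposition n) t ->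
  exists2 l, {in l, forall p : 'I_n * 'I_n, p.1 < p.2} & t = map (@edge_perm n) l.
Proof.
elim: t => [|s t IH] /=; first by exists [::].
case/andP => /existsP[a /existsP[b /andP[ab /eqP sE]]] /IH[l ll ->].
case: (ltngtP a b) => [ltab|ltba|/val_inj eab]; last by rewrite eab eqxx in ab.
- exists ((a, b) :: l); last by rewrite sE.
  by move=> p; rewrite inE => /orP[/eqP -> //|/ll].
- exists ((b, a) :: l); last by rewrite /= sE /edge_perm tpermC.
  by move=> p; rewrite inE => /orP[/eqP -> //|/ll].
Qed.

Definition trees n : seq (seq ('I_n * 'I_n)) :=
  [seq x.2 | x <- forests (enum 'I_n) & size x.1 == 1].

Lemma enum_ord_sorted n : sorted (fun i j : 'I_n => i < j) (enum 'I_n).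
Proof.
by have := iota_ltn_sorted 0 n; rewrite -val_enum_ord sorted_map.
Qed.

Lemma treesP n l : 0 < n ->
  reflect (([:: enum 'I_n], l) \in forests (enum 'I_n)) (l \in trees n).
Proof.
move=> n0; apply: (iffP mapP) => [[x]|H].
  rewrite mem_filter => /andP[/eqP x1 xf ->].
  have := forests_flatten xf; case: x x1 xf => -[|u [|]] //= t _ xf.
  by rewrite cats0 => ue; rewrite ue in xf.
by exists ([:: enum 'I_n], l); rewrite // mem_filter.
Qed.

Lemma trees_uniq n : 0 < n -> uniq (trees n).
Proof.
move=> n0; rewrite map_inj_in_uniq ?filter_uniq ?forests_uniq ?enum_uniq //.
move=> -[L t] [L' t']; rewrite !mem_filter /= => /andP[L1 /forests_flatten /= LE].
case/andP=> L1' /forests_flatten /= LE' ->; congr (_, _).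
case: L L1 LE => [|u [|]] //= _; rewrite cats0 => ->.
by case: L' L1' LE' => [|u' [|]] //= _; rewrite cats0 => ->.
Qed.

Lemma count_trees n k : 
  count (fun l => lower_count l == k) (trees n) = narayana_count n k.
Proof.
have := forests_shapes (enum_uniq 'I_n); rewrite size_enum_ord /narayana_count => <-.
rewrite /trees !count_map count_filter; apply: eq_count => x /=.
by rewrite andbC.
Qed.

Lemma trees_edge_lt n l : 0 < n -> l \in trees n ->
  {in l, forall p : 'I_n * 'I_n, p.1 < p.2}.
Proof.
move=> n0 /(treesP _ n0) H p pl.
by apply: (forests_edge_lt (enum_ord_sorted n) H).
Qed.

(** The tuple length [n.-1] is the size that [forests_complete] asks for when all labels form a
    single cycle; the converse is [forests_prod] with [forests_sorted]. *)
Lemma mem_increasing_factorisations n (t : n.-1.-tuple 'S_n) : 0 < n ->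
  t \in increasing_factorisations n <->
  exists2 l, l \in trees n & tval t = map (@edge_perm n) l.
Proof.
move=> n0; rewrite inE /increasing_factorisation /minimal_factorisation.
have U := enum_uniq 'I_n.
have prodE l : (\prod_(s <- map (@edge_perm n) l) s)%g = tperm_prod l.
  by rewrite big_map.
have S1 : tperm_prod (stars [:: enum 'I_n]) = long_cycle n.
  by rewrite /stars /= cats0 star_enum.
split.
  case/andP => /andP[/transpositions_edges[l ll tE] /eqP P] /forallP I.
  exists l => //; apply/(treesP _ n0).
  have Sl : size l = n.-1 by rewrite -(size_tuple t) tE size_map.
  apply: forests_complete => /=.
  - exact: enum_ord_sorted.
  - exact: cats0.
  - by rewrite inE; apply/eqP => E; have := size_enum_ord n; rewrite -E /= => n1; rewrite -n1 in n0.
  - by move=> p pl; rewrite ll // mem_enum.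
  - rewrite sorted_pairwise; last exact: edge_le_trans.
    have x0 : 'I_n * 'I_n by split; exact: (Ordinal n0).
    apply/(pairwiseP x0) => i j; rewrite !inE => il jl ij.
    have il' : i < n.-1 by rewrite -Sl.
    have jl' : j < n.-1 by rewrite -Sl.
    move/forallP: (I (Ordinal il')) => /(_ (Ordinal jl')) /implyP /(_ (ltnW ij)).
    rewrite !(tnth_edge x0 _ tE) /=; set p := nth x0 l i; set q := nth x0 l j.
    move=> /forallP/(_ p.1)/forallP/(_ p.2)/forallP/(_ q.1)/forallP/(_ q.2).
    by rewrite !transposition_ends_edge ?ll ?mem_nth // -!surjective_pairing !eqxx.
  - by rewrite S1 -P tE prodE.
  - by rewrite Sl size_enum_ord addn1 prednK.
case=> l lt tE; have ll := trees_edge_lt n0 lt; move/(treesP _ n0): lt => lf.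
apply/andP; split; first (apply/andP; split).
- rewrite tE; apply/allP => _ /mapP[p pl ->]; apply/existsP; exists p.1.
  apply/existsP; exists p.2; rewrite eqxx andbT.
  by apply: contraTneq (ll _ pl) => ->; rewrite ltnn.
- by rewrite tE prodE (forests_prod U lf) S1.
- apply/forallP => i; apply/forallP => j; apply/implyP => ij.
  do 4 (apply/forallP => ?); apply/implyP => H1; apply/implyP.
  move: H1; have x0 : 'I_n * 'I_n by split; exact: (Ordinal n0).
  have Sl : size l = n.-1 by rewrite -(size_tuple t) tE size_map.
  have kl (k : 'I_n.-1) : nth x0 l k \in l by rewrite mem_nth // Sl.
  rewrite !(tnth_edge x0 _ tE) !transposition_ends_edge ?ll //.
  have St := forests_sorted (enum_ord_sorted n) lf.
  have er : reflexive (@edge_le n) by move=> p; apply: leqnn.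
  have := sorted_leq_nth (@edge_le_trans n) er x0 St.
  move=> /(_ i j); rewrite !inE !Sl !ltn_ord => /(_ isT isT ij).
  by move=> + /eqP E1 /eqP E2; rewrite /edge_le -E1 -E2.
Qed.

Lemma lower_ends_trees n (t : n.-1.-tuple 'S_n) l : 0 < n -> l \in trees n ->
  tval t = map (@edge_perm n) l -> forall a, (a \in lower_ends t) = (a \in unzip1 l).
Proof.
move=> n0 lt tE a; have ll := trees_edge_lt n0 lt.
have Sl : size l = n.-1 by rewrite -(size_tuple t) tE size_map.
have x0 : 'I_n * 'I_n by split; exact: (Ordinal n0).
have tn k := tnth_edge x0 k tE.
have kl (k : 'I_n.-1) : nth x0 l k \in l by rewrite mem_nth // Sl.
rewrite inE; apply/existsP/mapP => [[i /existsP[b]]|[p pl ->]].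
  by rewrite tn transposition_ends_edge ?ll // => /eqP E; exists (a, b) => //; rewrite E.
have il : index p l < n.-1 by rewrite -Sl index_mem.
exists (Ordinal il); apply/existsP; exists p.2.
by rewrite tn transposition_ends_edge ?ll //= nth_index // -surjective_pairing.
Qed.

Lemma upper_ends_trees n (t : n.-1.-tuple 'S_n) l : 0 < n -> l \in trees n ->
  tval t = map (@edge_perm n) l -> forall b, (b \in upper_ends t) = (b \in unzip2 l).
Proof.
move=> n0 lt tE b; have ll := trees_edge_lt n0 lt.
have Sl : size l = n.-1 by rewrite -(size_tuple t) tE size_map.
have x0 : 'I_n * 'I_n by split; exact: (Ordinal n0).
have tn k := tnth_edge x0 k tE.
have kl (k : 'I_n.-1) : nth x0 l k \in l by rewrite mem_nth // Sl.
rewrite inE; apply/existsP/mapP => [[i /existsP[a]]|[p pl ->]].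
  by rewrite tn transposition_ends_edge ?ll // => /eqP E; exists (a, b) => //; rewrite E.
have il : index p l < n.-1 by rewrite -Sl index_mem.
exists (Ordinal il); apply/existsP; exists p.1.
by rewrite tn transposition_ends_edge ?ll //= nth_index // -surjective_pairing.
Qed.

(** The exception for last nodes in [forests_lowerE] disappears: in a tree with at least two nodes
    the last node is an upper end. *)
Lemma trees_lower_upper n l a : 1 < n -> l \in trees n ->
  (a \in unzip1 l) = (a \notin unzip2 l).
Proof.
move=> n1 /(treesP _ (ltnW n1)) lf.
rewrite (forests_lowerE (enum_uniq 'I_n) lf (mem_enum _ _)) /= inE.
have Sn := size_enum_ord n.
case E : (enum 'I_n) lf Sn => [|b v] lf Sn; first by rewrite -Sn in n1.
have v0 : v != [::].
  by apply: contraTneq n1 => v0; rewrite -(size_enum_ord n) E v0.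
have /= := @forests_last_upper _ _ _ b v lf (mem_head _ _) v0.
have [->|] := eqVneq a (last b v); last by rewrite andbT.
by move=> ->.
Qed.

Lemma card_increasing_factorisations n (Q : pred nat) : 0 < n ->
  #|[set t in increasing_factorisations n | Q #|lower_ends t|]| =
  count (fun l => Q (lower_count l)) (trees n).
Proof.
move=> n0; set A := [set t in _ | _].
have lc t l : l \in trees n -> tval t = map (@edge_perm n) l ->
    #|lower_ends t| = lower_count l.
  move=> lt tE; rewrite /lower_count -(card_uniqP (undup_uniq _)).
  by apply: eq_card => a; rewrite mem_undup (lower_ends_trees n0 lt tE).
rewrite cardE -(size_map val) -size_filter -(size_map (map (@edge_perm n))).
apply: perm_size; apply: uniq_perm.
- by rewrite map_inj_uniq ?enum_uniq //; apply: val_inj.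
- rewrite map_inj_in_uniq ?filter_uniq ?trees_uniq // => l1 l2.
  rewrite !mem_filter => /andP[_ /(trees_edge_lt n0) H1] /andP[_ /(trees_edge_lt n0) H2].
  exact: edge_perm_inj.
move=> t; apply/mapP/mapP => [[x]|[l]].
  rewrite mem_enum inE => /andP[/(mem_increasing_factorisations _ n0)[l lt xE] Qx] ->.
  by exists l => //; rewrite mem_filter lt -(lc x l) // Qx.
rewrite mem_filter => /andP[Ql lt] tE.
have Sl : size t == n.-1.
  rewrite tE size_map; move/(treesP _ n0): lt => /forests_size /=.
  by rewrite size_enum_ord addn1 => E; rewrite -[X in _ == X.-1]E.
exists (Tuple Sl) => //; rewrite mem_enum inE (lc _ l) // Ql andbT.
by apply/mem_increasing_factorisations => //; exists l.
Qed.

Local Open Scope classical_set_scope.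
Local Open Scope ring_scope.

(** * Narayana weights near their mode *)

(* n - 1 times a Narayana number for 0 < k; at k = 0 the junk value is 1. *)
Definition narayana_weight (n k : nat) : nat := ('C(n.-1, k) * 'C(n.-1, k.-1))%N.

Lemma narayana_weightS n k : (0 < k)%N ->
  (narayana_weight n k.+1 * (k * k.+1) = narayana_weight n k * ((n.-1 - k) * (n - k)))%N.
Proof.
case: k => // k _; rewrite /narayana_weight /=; case: n => [|m] /=.
  by rewrite !bin0n !mul0n.
have := mul_bin_left m k.+1; have := mul_bin_left m k; rewrite subSS.
move: 'C(m, k) 'C(m, k.+1) 'C(m, k.+2) => a b c E1 E2.
transitivity ((k.+2 * c) * (k.+1 * b))%N; first lia.
by rewrite E1 E2; lia.
Qed.

Lemma narayana_weight_sym n k : (0 < k < n)%N ->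
  narayana_weight n (n - k) = narayana_weight n k.
Proof.
case/andP => k0 kn; rewrite /narayana_weight.
rewrite (_ : n - k = n.-1 - k.-1)%N; last lia.
rewrite (_ : (n.-1 - k.-1).-1 = n.-1 - k)%N; last lia.
by rewrite !bin_sub 1?mulnC //; lia.
Qed.

Lemma narayana_weight_gt0 n k : (0 < k < n)%N -> (0 < narayana_weight n k)%N.
Proof. by case/andP=> k0 kn; rewrite muln_gt0 !bin_gt0; lia. Qed.

(** With s = 2k + 1 - n the quotient of the weights at k + 1 and k is (1 - s/k)(1 - s/(k+1)); both
    denominators are at most [M], and 1 - x is at most exp(-x). *)
Lemma narayana_weight_step_le (R : realType) (n k M : nat) : (0 < k)%N -> (k < M)%N ->
  (n <= k.*2.+1)%N -> (k < n)%N ->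
  (narayana_weight n k.+1)%:R <= (narayana_weight n k)%:R *
    expR (- (2 * (k.*2.+1 - n)%:R / M%:R)) :> R.
Proof.
move=> k0 kM nk kn.
have k0R : 0 < k%:R :> R by rewrite ltr0n.
have kMR : k%:R + 1 <= M%:R :> R by rewrite natr1 ler_nat.
have E : (narayana_weight n k.+1)%:R * (k%:R * (k%:R + 1)) =
   (narayana_weight n k)%:R * ((n%:R - 1 - k%:R) * (n%:R - k%:R)) :> R.
  have := congr1 (fun z => z%:R : R) (narayana_weightS n k0).
  rewrite !natrM -natr1 => ->; rewrite natrB; last lia.
  rewrite natrB; last lia.
  by rewrite -subn1 natrB //; lia.
have knR : k%:R + 1 <= n%:R :> R by rewrite natr1 ler_nat.
set s : R := (k.*2.+1 - n)%:R.
have sE : s = 2 * k%:R + 1 - n%:R by rewrite /s natrB // -muln2 -natr1 natrM; ring.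
have s0 : 0 <= s by rewrite ler0n.
have ineq (d : R) : 0 < d -> d <= M%:R -> 1 - s / d <= expR (- (s / M%:R)).
  move=> d0 dM; apply: le_trans (expR_ge1Dx _).
  by rewrite lerD2l lerN2 ler_wpM2l // lef_pV2 // posrE; lra.
have -> : expR (- (2 * s / M%:R)) = expR (- (s / M%:R)) * expR (- (s / M%:R)).
  by rewrite -expRD; congr expR; lra.
have -> : (narayana_weight n k.+1)%:R =
   (narayana_weight n k)%:R * ((1 - s / k%:R) * (1 - s / (k%:R + 1))) :> R.
  apply: (@mulIf _ (k%:R * (k%:R + 1))); first by rewrite mulf_neq0 //; lra.
  rewrite E sE; field; lra.
rewrite ler_wpM2l // ler_pM //; last 2 first.
- by apply: ineq => //; lra.
- by apply: ineq => //; lra.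
- by rewrite subr_ge0 ler_pdivrMr //; lra.
- by rewrite subr_ge0 ler_pdivrMr //; lra.
Qed.

(** The reciprocal quotient is (1 + s/(n-1-k))(1 + s/(n-k)) with the same s; both denominators are
    at least [M], and 1 + x is at most exp(x). *)
Lemma narayana_weight_step_ge (R : realType) (n k M : nat) : (0 < k)%N -> (M < n - k)%N ->
  (0 < M)%N -> (n <= k.*2.+1)%N ->
  (narayana_weight n k)%:R * expR (- (2 * (k.*2.+1 - n)%:R / M%:R)) <=
  (narayana_weight n k.+1)%:R :> R.
Proof.
move=> k0 kM M0 nk.
have k0R : 0 < k%:R :> R by rewrite ltr0n.
have kn : (k < n)%N by lia.
have M0R : 0 < M%:R :> R by rewrite ltr0n.
have kMR : M%:R + 1 <= n%:R - k%:R :> R by rewrite -natrB ?natr1 ?ler_nat //; lia.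
have E : (narayana_weight n k.+1)%:R * (k%:R * (k%:R + 1)) =
   (narayana_weight n k)%:R * ((n%:R - 1 - k%:R) * (n%:R - k%:R)) :> R.
  have := congr1 (fun z => z%:R : R) (narayana_weightS n k0).
  rewrite !natrM -natr1 => ->; rewrite natrB; last lia.
  rewrite natrB; last lia.
  by rewrite -subn1 natrB //; lia.
set s : R := (k.*2.+1 - n)%:R.
have sE : s = 2 * k%:R + 1 - n%:R by rewrite /s natrB // -muln2 -natr1 natrM; ring.
have s0 : 0 <= s by rewrite ler0n.
have ineq (d : R) : 0 < d -> M%:R <= d -> 1 + s / d <= expR (s / M%:R).
  move=> d0 dM; apply: le_trans (expR_ge1Dx _).
  by rewrite lerD2l ler_wpM2l // lef_pV2 // posrE; lra.
rewrite expRN ler_pdivrMr ?expR_gt0 //.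
have -> : expR (2 * s / M%:R) = expR (s / M%:R) * expR (s / M%:R).
  by rewrite -expRD; congr expR; lra.
have -> : (narayana_weight n k)%:R =
   (narayana_weight n k.+1)%:R * ((1 + s / (n%:R - 1 - k%:R)) * (1 + s / (n%:R - k%:R))) :> R.
  apply: (@mulIf _ ((n%:R - 1 - k%:R) * (n%:R - k%:R))).
    by rewrite mulf_neq0 // gt_eqF //; lra.
  rewrite -E sE; field; apply/andP; split; rewrite gt_eqF //; lra.
rewrite ler_wpM2l // ler_pM //; last 2 first.
- by apply: ineq; lra.
- by apply: ineq; lra.
- by rewrite addr_ge0 // divr_ge0 //; lra.
- by rewrite addr_ge0 // divr_ge0 //; lra.
Qed.

(** The steps from [n./2] contribute s = 2i + 1 - odd n for i < j, with sum j^2 - j odd n. The bound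
    [J] allows one denominator for all steps. *)
Lemma narayana_weight_le_mid (R : realType) (n j J : nat) : (1 < n)%N -> (j <= J)%N ->
  (n./2 + J < n)%N ->
  (narayana_weight n (n./2 + j))%:R <= (narayana_weight n n./2)%:R *
    expR (- (2 * (j%:R ^+ 2 - (odd n)%:R * j%:R) / (n./2 + J)%:R)) :> R.
Proof.
move=> n1; elim: j => [|j IH] jJ nJ.
  by rewrite addn0 expr0n mulr0 subrr mulr0 mul0r oppr0 expR0 mulr1.
have n2 := odd_double_half n.
rewrite addnS; apply: le_trans (@narayana_weight_step_le R n (n./2 + j) (n./2 + J) _ _ _ _) _;
  try by lia.
apply: le_trans (ler_wpM2r (expR_ge0 _) (IH (ltnW jJ) nJ)) _.
rewrite -[leLHS]mulrA -expRD ler_wpM2l // ler_expR.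
rewrite le_eqVlt; apply/orP; left; apply/eqP.
rewrite (_ : ((n./2 + j).*2.+1 - n)%N = (j.*2.+1 - odd n)%N); last lia.
rewrite (@natrB _ j.*2.+1 (odd n)); last by case: (odd n).
rewrite -(natr1 j.*2) -muln2 natrM -(natr1 j).
have : (n./2 + J)%:R != 0 :> R by rewrite pnatr_eq0; lia.
move: (n./2 + J)%:R (odd n)%:R => x e x0; field.
exact: x0.
Qed.

Lemma narayana_weight_ge_mid (R : realType) (n j J : nat) : (1 < n)%N -> (j <= J)%N ->
  (n./2 + J < n)%N ->
  (narayana_weight n n./2)%:R *
    expR (- (2 * (j%:R ^+ 2 - (odd n)%:R * j%:R) / (n - (n./2 + J))%:R))
  <= (narayana_weight n (n./2 + j))%:R :> R.
Proof.
move=> n1; elim: j => [|j IH] jJ nJ.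
  by rewrite addn0 expr0n mulr0 subrr mulr0 mul0r oppr0 expR0 mulr1.
have n2 := odd_double_half n.
rewrite addnS; apply: le_trans _ (@narayana_weight_step_ge R n (n./2 + j) (n - (n./2 + J)) _ _ _ _);
  try by lia.
apply: le_trans _ (ler_wpM2r (expR_ge0 _) (IH (ltnW jJ) nJ)).
rewrite -[leRHS]mulrA -expRD ler_wpM2l // ler_expR.
rewrite le_eqVlt; apply/orP; left; apply/eqP.
rewrite (_ : ((n./2 + j).*2.+1 - n)%N = (j.*2.+1 - odd n)%N); last lia.
rewrite (@natrB _ j.*2.+1 (odd n)); last by case: (odd n).
rewrite -(natr1 j.*2) -muln2 natrM -(natr1 j).
have : (n - (n./2 + J))%:R != 0 :> R by rewrite pnatr_eq0; lia.
move: (n - (n./2 + J))%:R (odd n)%:R => x e x0; field.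
exact: x0.
Qed.

(** By symmetry [k] may be replaced by the larger of k and n - k, written n./2 + J. Then u = J -
    (odd n)/2 and J^2 - J odd n = u^2 - (odd n)/4, whence the 1/4 in the upper bound. *)
Lemma narayana_weight_ratio (R : realType) (n k : nat) (u := `|k%:R - n%:R / 2| : R) :
  (0 < k < n)%N ->
  expR (- (2 * u ^+ 2 / (n%:R / 2 - u)))
    <= (narayana_weight n k)%:R / (narayana_weight n n./2)%:R
    <= expR (- (2 * (u ^+ 2 - 1 / 4) / (n%:R / 2 + u))).
Proof.
move=> kn; have n2 := odd_double_half n.
pose K := maxn k (n - k); pose J := (K - n./2)%N.
have WK : narayana_weight n k = narayana_weight n (n./2 + J).
  rewrite (_ : n./2 + J = K)%N; last by rewrite /J /K; lia.
  rewrite /K /maxn; case: ifP => _ //; by rewrite narayana_weight_sym.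
have n2R : n%:R / 2 = (n./2)%:R + (odd n)%:R / 2 :> R.
  by rewrite -{1}n2 natrD -muln2 natrM; field.
have uE : u = J%:R - (odd n)%:R / 2.
  rewrite /u n2R /J /K natrB; last by lia.
  rewrite /maxn; case: ltnP => h.
    rewrite natrB; last by lia.
    have : k%:R + k%:R <= n%:R :> R by rewrite -natrD ler_nat; lia.
    have -> : n%:R = 2 * (n./2)%:R + (odd n)%:R :> R by rewrite -{1}n2 natrD -muln2 natrM; ring.
    by move=> h2; rewrite ler0_norm; lra.
  have : n%:R <= k%:R + k%:R :> R by rewrite -natrD ler_nat; lia.
  have -> : n%:R = 2 * (n./2)%:R + (odd n)%:R :> R by rewrite -{1}n2 natrD -muln2 natrM; ring.
  by move=> h2; rewrite ger0_norm; lra.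
have Jn : (n./2 + J < n)%N by rewrite /J /K; lia.
have n1 : (1 < n)%N by lia.
have W0 : 0 < (narayana_weight n n./2)%:R :> R.
  by rewrite ltr0n narayana_weight_gt0 //; lia.
have uD : n%:R / 2 + u = (n./2 + J)%:R by rewrite uE n2R natrD; ring.
have uB : n%:R / 2 - u = (n - (n./2 + J))%:R.
  rewrite natrB; last by lia.
  have nE : n%:R = 2 * (n./2)%:R + (odd n)%:R :> R by rewrite -{1}n2 natrD -muln2 natrM; ring.
  by rewrite uE natrD n2R nE; field.
have oo : (odd n)%:R ^+ 2 = (odd n)%:R :> R by case: (odd n); rewrite ?expr1n // expr0n.
have u2 : J%:R ^+ 2 - (odd n)%:R * J%:R = u ^+ 2 - (odd n)%:R / 4.
  by rewrite uE -[X in _ = _ - X / 4]oo; field.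
have o01 : 0 <= ((odd n)%:R : R) <= 1 by case: (odd n); rewrite /= ?lexx ler01.
rewrite ler_pdivlMr // ler_pdivrMr // WK uD uB; apply/andP; split.
  rewrite mulrC; apply: le_trans _ (narayana_weight_ge_mid R n1 (leqnn J) Jn).
  rewrite ler_wpM2l // ler_expR lerN2 ler_wpM2r ?invr_ge0 // u2; lra.
rewrite mulrC; apply: le_trans (narayana_weight_le_mid R n1 (leqnn J) Jn) _.
rewrite ler_wpM2l // ler_expR lerN2 ler_wpM2r ?invr_ge0 // u2; lra.
Qed.

(** * The Gaussian limit *)

Definition grid (R : realType) (n k : nat) : R := (k%:R - n%:R / 2) / Num.sqrt n%:R.

Definition weight_ratio (R : realType) (n k : nat) : R :=
  (narayana_weight n k)%:R / (narayana_weight n n./2)%:R.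

Definition cell (R : realType) (n k : nat) : set R :=
  `[grid R n k, grid R n k + (Num.sqrt n%:R)^-1[%classic.

(* Scaled by the value of the normal density at 0, since [weight_ratio] is 1 at the
   mode k = n./2. *)
Definition step_density (R : realType) (D : R -> bool) (n : nat) (y : R) : R :=
  \sum_(k <- index_iota 1 n) (D (grid R n k))%:R *
    (normal_peak (Num.sqrt (1 / 8)) * weight_ratio R n k) * \1_(cell n k) y.

Lemma sqrtn_gt0 (R : realType) n : (0 < n)%N -> 0 < Num.sqrt n%:R :> R.
Proof. by move=> n0; rewrite sqrtr_gt0 ltr0n. Qed.

Lemma cellE (R : realType) n k (y : R) : (0 < n)%N ->
  cell n k y <-> k%:R <= y * Num.sqrt n%:R + n%:R / 2 < k%:R + 1.
Proof.
move=> n0; have s0 := sqrtn_gt0 R n0.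
rewrite /cell /grid /= in_itv /= ler_pdivrMr //.
have -> : (k%:R - n%:R / 2) / Num.sqrt n%:R + (Num.sqrt n%:R)^-1 =
   (k%:R - n%:R / 2 + 1) / Num.sqrt n%:R :> R by rewrite [in RHS]mulrDl mul1r.
rewrite ltr_pdivlMr //.
by split=> /andP[? ?]; apply/andP; split; lra.
Qed.

Lemma cell_inj (R : realType) n k k' (y : R) : (0 < n)%N ->
  cell n k y -> cell n k' y -> k = k'.
Proof.
move=> n0 /(cellE _ _ n0)/andP[a b] /(cellE _ _ n0)/andP[c d].
have : k%:R < k'%:R + 1 :> R by apply: le_lt_trans a d.
have : k'%:R < k%:R + 1 :> R by apply: le_lt_trans c b.
by rewrite !natr1 !ltr_nat; lia.
Qed.

Lemma step_density_cell (R : realType) (D : R -> bool) n k y :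
  (0 < k < n)%N -> cell n k y ->
  step_density D n y =
  (D (grid R n k))%:R * (normal_peak (Num.sqrt (1 / 8)) * weight_ratio R n k).
Proof.
move=> /andP[k0 kn] yk; have n0 : (0 < n)%N by lia.
rewrite /step_density (bigD1_seq k) ?iota_uniq ?mem_index_iota ?k0 //=.
rewrite big1_seq ?addr0; first by rewrite indicE mem_set // mulr1.
move=> i /andP[ik _]; rewrite indicE memNset ?mulr0 // => yi.
by rewrite (cell_inj n0 yi yk) eqxx in ik.
Qed.

Lemma step_density_nocell (R : realType) (D : R -> bool) n y :
  (forall k, (0 < k < n)%N -> ~ cell n k y) -> step_density D n y = 0.
Proof.
move=> H; apply: big1_seq => k /=; rewrite mem_index_iota => kn.
by rewrite indicE memNset ?mulr0 //; apply: H.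
Qed.

Lemma weight_ratio_ge0 (R : realType) n k : 0 <= weight_ratio R n k.
Proof. by rewrite divr_ge0. Qed.

Lemma peak_ge0 (R : realType) : 0 <= normal_peak (Num.sqrt (1 / 8)) :> R.
Proof. exact: normal_peak_ge0. Qed.

Lemma step_density_ge0 (R : realType) (D : R -> bool) n y : 0 <= step_density D n y.
Proof.
apply: sumr_ge0 => k _.
by rewrite !mulr_ge0 ?ler0n ?peak_ge0 ?weight_ratio_ge0 // indicE ler0n.
Qed.

Lemma measurable_cell (R : realType) n k : measurable (@cell R n k).
Proof. exact: measurable_itv. Qed.

Lemma measurable_step_density (R : realType) (D : R -> bool) n :
  measurable_fun setT (step_density D n).
Proof.
rewrite /step_density; apply: measurable_sum => k.
by apply: measurable_funM => //; apply: measurable_indic; apply: measurable_cell.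
Qed.

Lemma integral_step_density (R : realType) (D : R -> bool) n :
  (\int[lebesgue_measure]_y (step_density D n y)%:E)%E =
  (normal_peak (Num.sqrt (1 / 8)) / (Num.sqrt n%:R * (narayana_weight n n./2)%:R) *
   (\sum_(1 <= k < n | D (grid R n k)) narayana_weight n k)%:R)%:E.
Proof.
under eq_integral do rewrite /step_density -sumEFin.
rewrite (ge0_integral_sum lebesgue_measure measurableT
  (f := fun k y => ((D (grid R n k))%:R *
     (normal_peak (Num.sqrt (1 / 8)) * weight_ratio R n k) * \1_(cell n k) y)%:E)); last 2 first.
- move=> k; apply/measurable_EFinP; apply: measurable_funM => //.
  by apply: measurable_indic; apply: measurable_cell.
- move=> k y _; rewrite lee_fin.
  by rewrite !mulr_ge0 ?ler0n ?peak_ge0 ?weight_ratio_ge0 // indicE ler0n.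
rewrite natr_sum mulr_sumr -sumEFin [RHS]big_mkcond /=.
apply: eq_big_seq => k; rewrite mem_index_iota => kn.
have n0 : (0 < n)%N by lia.
under eq_integral do rewrite EFinM.
rewrite ge0_integralZl //; last 2 first.
- by apply/measurable_EFinP; apply: measurable_indic; apply: measurable_cell.
- by rewrite lee_fin !mulr_ge0 ?ler0n ?peak_ge0 ?weight_ratio_ge0.
rewrite integral_indic //; last exact: measurable_cell.
rewrite setIT /cell /= lebesgue_measure_itv /= lte_fin ltrDl invr_gt0 sqrtn_gt0 //.
rewrite -EFinB -EFinM addrAC subrr add0r.
case: (D _); last by rewrite !mul0r.
rewrite /weight_ratio; congr EFin.
by rewrite !mul1r invfM; ring.
Qed.

(** An integrable bound independent of [n]. With z = k - n/2 the weight ratio has exponent at most 1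
    - 2z^2/n, while y^2 is at most 2z^2/n + 2; this gives the constant 3 = 1 + 2. *)
Lemma step_density_le (R : realType) (D : R -> bool) n (y : R) :
  step_density D n y <= normal_peak (Num.sqrt (1 / 8)) * expR 3 * gauss_fun y.
Proof.
have [[k kn yk]|H] := pselect (exists2 k, (0 < k < n)%N & cell n k y); last first.
  rewrite step_density_nocell; last by move=> k kn yk; apply: H; exists k.
  by rewrite !mulr_ge0 ?peak_ge0 ?expR_ge0 // gauss_fun_ge0.
rewrite (step_density_cell _ kn yk).
have n0 : (0 < n)%N by lia.
have s0 := sqrtn_gt0 R n0.
rewrite /gauss_fun -mulrA -expRD.
apply: (@le_trans _ _ (1 * (normal_peak (Num.sqrt (1 / 8)) * weight_ratio R n k))).
  by rewrite ler_wpM2r ?mulr_ge0 ?peak_ge0 ?weight_ratio_ge0 //; case: (D _).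
rewrite mul1r ler_wpM2l ?peak_ge0 //.
have /andP[_ le2] := narayana_weight_ratio R kn.
apply: le_trans le2 _; rewrite ler_expR.
have n1 : 1 <= n%:R :> R by rewrite ler1n.
move: yk => /(cellE _ _ n0); set s := Num.sqrt _ in s0 *.
have sE : n%:R = s ^+ 2 by rewrite sqr_sqrtr.
set z := k%:R - n%:R / 2 => yk.
have zn : `|z| <= n%:R / 2.
  rewrite ler_norml /z; have : 0 <= k%:R :> R by [].
  have : k%:R <= n%:R :> R by rewrite ler_nat; lia.
  by move=> ? ?; apply/andP; split; lra.
have yz : `|y * s - z| <= 1.
  by rewrite ler_norml /z; move/andP: yk => [? ?]; apply/andP; split; lra.
have zz : `|z| ^+ 2 = z ^+ 2 by rewrite real_normK // num_real.
have d0 : 0 < n%:R / 2 + `|z| by have := normr_ge0 z; lra.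
have dn : n%:R / 2 + `|z| <= n%:R by lra.
have dh : 1 / 2 <= n%:R / 2 + `|z| by have := normr_ge0 z; lra.
have n0R : 0 < n%:R :> R by rewrite ltr0n.
(* For w = ys this is w^2 <= 2z^2 + 2(w - z)^2, equivalent to 0 <= (2z - w)^2. *)
have y2 : y ^+ 2 <= (2 * z ^+ 2 + 2) / n%:R.
  rewrite ler_pdivlMr // sE -exprMn.
  have : (y * s - z) ^+ 2 <= 1 by rewrite -real_normK ?num_real // expr_le1.
  have := sqr_ge0 (2 * z - y * s).
  by move: (y * s) => w; rewrite !expr2; nra.
have h1 : 2 * z ^+ 2 / n%:R <= 2 * z ^+ 2 / (n%:R / 2 + `|z|).
  by apply: ler_wpM2l; [rewrite mulr_ge0 ?sqr_ge0 | rewrite lef_pV2 ?posrE].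
have h2 : (1 / 2) / (n%:R / 2 + `|z|) <= 1 by rewrite ler_pdivrMr //; lra.
have h3 : 2 / n%:R <= 2 :> R by rewrite ler_pdivrMr //; lra.
rewrite zz.
have -> : 2 * (z ^+ 2 - 1 / 4) / (n%:R / 2 + `|z|) =
  2 * z ^+ 2 / (n%:R / 2 + `|z|) - (1 / 2) / (n%:R / 2 + `|z|).
  by field; rewrite gt_eqF //; have := normr_ge0 z; lra.
have y2' : (2 * z ^+ 2 + 2) / n%:R = 2 * z ^+ 2 / n%:R + 2 / n%:R by rewrite mulrDl.
lra.
Qed.

(** * Pointwise convergence to the normal density *)

Lemma cvg_inv_natr (R : realType) : (n%:R^-1 : R) @[n --> \oo] --> 0.
Proof. by rewrite -cvg_shiftS; exact: cvg_harmonic. Qed.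

Lemma cvg_inv_sqrtn (R : realType) : ((Num.sqrt n%:R)^-1 : R) @[n --> \oo] --> 0.
Proof.
have -> : (fun n => (Num.sqrt n%:R)^-1 : R) = (fun n => Num.sqrt (n%:R^-1 : R)).
  by apply/funext => n; rewrite sqrtrV.
rewrite -[X in _ --> X]sqrtr0.
apply: (cvg_comp _ _ (@cvg_inv_natr R)).
exact: sqrt_continuous.
Qed.

Lemma normal_pdf_eighth (R : realType) (y : R) :
  normal_pdf 0 (Num.sqrt (1 / 8)) y = normal_peak (Num.sqrt (1 / 8)) * expR (- (4 * y ^+ 2)).
Proof.
rewrite normal_pdfE; last by rewrite gt_eqF // sqrtr_gt0; lra.
rewrite /normal_fun; congr (_ * expR _).
by rewrite subr0 sqr_sqrtr; [field | lra].
Qed.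

(** [narayana_weight_ratio] in the rescaled variable, where both exponents visibly tend to -4c^2.
    The bound 1/4 keeps the denominator 1 - 2|c|/sqrt n at least 1/2. *)
Lemma weight_ratio_grid (R : realType) n k (c := grid R n k) : (0 < k < n)%N ->
  `|c| * (Num.sqrt n%:R)^-1 <= 1 / 4 ->
  expR (- (4 * c ^+ 2 / (1 - 2 * `|c| * (Num.sqrt n%:R)^-1))) <= weight_ratio R n k
  <= expR (- ((4 * c ^+ 2 - n%:R^-1) / (1 + 2 * `|c| * (Num.sqrt n%:R)^-1))).
Proof.
move=> kn cb; have n0 : (0 < n)%N by lia.
have s0 := sqrtn_gt0 R n0; have := narayana_weight_ratio R kn.
have -> : `|k%:R - n%:R / 2| = `|c| * Num.sqrt n%:R :> R.
  by rewrite /c /grid normrM normfV (gtr0_norm s0) divfK // gt_eqF.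
have sE : n%:R = Num.sqrt n%:R ^+ 2 :> R by rewrite sqr_sqrtr.
rewrite -(real_normK (num_real c)); move: cb.
rewrite sE sqrtr_sqr (gtr0_norm s0); move: s0; move: (Num.sqrt n%:R) => s s0.
move: (normr_ge0 c); move: `|c| => a a0 cb.
have as1 : a <= s / 4 by move: cb; rewrite ler_pdivrMr //; lra.
have -> : 2 * (a * s) ^+ 2 / (s ^+ 2 / 2 - a * s) = 4 * a ^+ 2 / (1 - 2 * a / s).
  have p1 : 0 < s - 2 * a by lra.
  have p2 : 0 < s ^+ 2 + - (a * s) * 2.
    by rewrite (_ : _ + _ = s * (s - 2 * a)); [exact: mulr_gt0 | ring].
  by field; rewrite !gt_eqF.
have -> : 2 * ((a * s) ^+ 2 - 1 / 4) / (s ^+ 2 / 2 + a * s) =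
    (4 * a ^+ 2 - (s ^+ 2)^-1) / (1 + 2 * a / s).
  have p1 : 0 < s + 2 * a by lra.
  have p2 : 0 < s ^+ 2 + a * s * 2.
    by rewrite (_ : _ + _ = s * (s + 2 * a)); [exact: mulr_gt0 | ring].
  by field; rewrite !gt_eqF.
by [].
Qed.

Lemma step_density_cvg (R : realType) (D : R -> bool) (y : R) :
  (exists2 e, 0 < e & forall c, `|c - y| <= e -> D c = D y) ->
  step_density D n y @[n --> \oo] --> (D y)%:R * normal_pdf 0 (Num.sqrt (1 / 8)) y.
Proof.
move=> [e e0 De]; rewrite normal_pdf_eighth.
(* By [cellE] this is the index of the cell that contains [y], as soon as the truncated number is
   nonnegative. *)
pose K (n : nat) := Num.truncn (y * Num.sqrt n%:R + n%:R / 2).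
pose c n := grid R n (K n).
have inv0 := @cvg_inv_sqrtn R.
(* The bound 1/8 places the number truncated by [K] between 3n/8 and 5n/8, so that 0 < K n < n.
   Together with the bound 1/4 it gives |c n|/sqrt n <= 1/8 + 1/16, as [weight_ratio_grid] needs. *)
have big : \forall n \near \oo, [/\ (3 < n)%N, `|y| * (Num.sqrt n%:R)^-1 <= 1 / 8,
    (Num.sqrt n%:R)^-1 <= 1 / 4 :> R & (Num.sqrt n%:R)^-1 <= e].
  have H b : 0 < b -> \forall n \near \oo, (Num.sqrt n%:R)^-1 <= b :> R.
    move=> b0; have /cvgr_dist_le/(_ b b0) := inv0.
    apply: filterS => n; rewrite sub0r normrN ger0_norm // invr_ge0 sqrtr_ge0 //.
  have yb : 0 < (8 * (1 + `|y|))^-1 by rewrite invr_gt0; have := normr_ge0 y; lra.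
  near=> n; split.
  - by near: n; exact: nbhs_infty_gt.
  - have : (Num.sqrt n%:R)^-1 <= (8 * (1 + `|y|))^-1 by near: n; exact: H.
    move=> h; apply: (@le_trans _ _ (`|y| * (8 * (1 + `|y|))^-1)).
      by rewrite ler_wpM2l.
    by rewrite ler_pdivrMr; have := normr_ge0 y; lra.
  - by near: n; apply: H; lra.
  - by near: n; exact: H.
have good : \forall n \near \oo,
    [/\ (0 < K n < n)%N, cell n (K n) y & `|c n - y| <= (Num.sqrt n%:R)^-1].
  apply: filterS big => n [n3 yb s4 _].
  have n0 : (0 < n)%N by lia.
  have s0 := sqrtn_gt0 R n0.
  have n3R : 4 <= n%:R :> R by rewrite ler_nat.
  have sE : n%:R = Num.sqrt n%:R ^+ 2 :> R by rewrite sqr_sqrtr.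
  have ysn : `|y * Num.sqrt n%:R| <= n%:R / 8.
    rewrite normrM (gtr0_norm s0) [X in _ <= X / 8]sE.
    move: yb; rewrite ler_pdivrMr // => yb.
    by rewrite expr2 mulrAC ler_pM2r //; lra.
  have /andP[l1 l2] : - (n%:R / 8) <= y * Num.sqrt n%:R <= n%:R / 8 by rewrite -ler_norml.
  have z0 : 0 <= y * Num.sqrt n%:R + n%:R / 2 by lra.
  have /andP[t1 t2] := truncn_itv z0.
  rewrite -/(K n) in t1 t2.
  have yc : cell n (K n) y by apply/(cellE _ _ n0); rewrite t1 natr1.
  split=> //.
    apply/andP; split.
      by rewrite lt0n; apply: contraTneq t2 => ->; rewrite -leNgt; lra.
    by rewrite -(ltr_nat R); lra.
  move: yc; rewrite /cell /= in_itv /= => /andP[c1 c2].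
  by rewrite ler0_norm; rewrite /c; lra.
have cy : c n @[n --> \oo] --> y.
  apply/cvgrPdistC_le => b b0.
  have /cvgr_dist_le/(_ b b0) := inv0.
  move: good; apply: filterS2 => n [_ _ cn].
  by rewrite sub0r normrN ger0_norm ?invr_ge0 ?sqrtr_ge0 //; apply: le_trans.
have eqf : \forall n \near \oo, (D y)%:R * (normal_peak (Num.sqrt (1 / 8)) * weight_ratio R n (K n))
    = step_density D n y.
  move: big good; apply: filterS2 => n [_ _ _ se] [Kn yc cn].
  by rewrite (step_density_cell _ Kn yc) De //; apply: le_trans se.
apply: cvg_trans (near_eq_cvg eqf) _.
apply: cvgMr; apply: cvgMr.
have nc : `|c n| @[n --> \oo] --> `|y| by apply: cvg_norm.
have den0 : (2 * `|c n| * (Num.sqrt n%:R)^-1) @[n --> \oo] --> 0.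
  rewrite -(mulr0 (2 * `|y|)); apply: cvgM => //.
  by apply: cvgMr.
have num : 4 * c n ^+ 2 @[n --> \oo] --> 4 * y ^+ 2.
  apply: cvgMr; rewrite expr2; under eq_fun do rewrite expr2.
  exact: cvgM.
apply: (@squeeze_cvgr _ _ _ _
  (fun n => expR (- (4 * c n ^+ 2 / (1 - 2 * `|c n| * (Num.sqrt n%:R)^-1))))
  (fun n => expR (- ((4 * c n ^+ 2 - n%:R^-1) / (1 + 2 * `|c n| * (Num.sqrt n%:R)^-1))))).
- move: big good; apply: filterS2 => n [n3 yb s4 _] [Kn yc cn].
  apply: weight_ratio_grid => //.
  have s0 : 0 <= (Num.sqrt n%:R)^-1 :> R by rewrite invr_ge0.
  have : `|c n| <= `|y| + (Num.sqrt n%:R)^-1.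
    by have := ler_normD y (c n - y); rewrite addrC subrK; lra.
  move=> h; apply: (le_trans (ler_wpM2r s0 h)); rewrite mulrDl.
  have : (Num.sqrt n%:R)^-1 * (Num.sqrt n%:R)^-1 <= 1 / 4 * (1 / 4) :> R by apply: ler_pM.
  lra.
- apply: (cvg_comp _ expR); last exact: continuous_expR.
  apply: cvgN; rewrite -[X in _ --> X]divr1; apply: cvgM => //.
  apply: cvgV; first by rewrite oner_eq0.
  by rewrite -[X in _ --> X]subr0; apply: cvgB => //; apply: cvg_cst.
- apply: (cvg_comp _ expR); last exact: continuous_expR.
  apply: cvgN; rewrite -[X in _ --> X]divr1; apply: cvgM.
    rewrite -[X in _ --> X]subr0; apply: cvgB => //; exact: cvg_inv_natr.
  apply: cvgV; first by rewrite oner_eq0.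
  by rewrite -[X in _ --> X]addr0; apply: cvgD => //; apply: cvg_cst.
Unshelve. all: by end_near.
Qed.

(** Dominated convergence; the possible jump of [D] at [x] is a null set. *)
Lemma integral_step_density_cvg (R : realType) (D : R -> bool) (x : R) :
  measurable [set y | D y] ->
  (forall y, y != x -> exists2 e, 0 < e & forall c, `|c - y| <= e -> D c = D y) ->
  (\int[lebesgue_measure]_y (step_density D n y)%:E)%E @[n --> \oo] -->
  normal_prob 0 (Num.sqrt (1 / 8)) [set y | D y].
Proof.
move=> mD HD.
pose f (y : R) := ((D y)%:R * normal_pdf 0 (Num.sqrt (1 / 8)) y)%:E.
pose g (y : R) := (normal_peak (Num.sqrt (1 / 8)) * expR 3 * gauss_fun y)%:E.
have fE : f = (fun y => (\1_[set y | D y] y * normal_pdf 0 (Num.sqrt (1 / 8)) y)%:E).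
  apply/funext => y; rewrite /f indicE.
  by case: (boolP (D y)) => Dy; [rewrite mem_set | rewrite memNset //; exact/negP].
have [||||| _ _] := @dominated_convergence _ _ R lebesgue_measure setT measurableT
  (fun n y => (step_density D n y)%:E) f g.
- by move=> n; apply/measurable_EFinP; exact: measurable_step_density.
- rewrite fE; apply/measurable_EFinP; apply: measurable_funM.
    exact: measurable_indic.
  exact: measurable_normal_pdf.
- exists [set x]; split=> //; first exact: lebesgue_measure_set1.
  move=> y /= H; apply: contrapT => /eqP yx; apply: H => _.
  by apply: cvg_EFin; [exact: nearW | exact: step_density_cvg (HD y yx)].
- rewrite /g; under [X in _.-integrable _ X]eq_fun do rewrite EFinM.
  by apply: integrableZl => //; exact: integrableT_gauss.
- apply: aeW => y n _; rewrite gee0_abs ?lee_fin ?step_density_ge0 //.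
  exact: step_density_le.
rewrite [X in _ --> X -> _](_ : _ = normal_prob 0 (Num.sqrt (1 / 8)) [set y | D y]) //.
rewrite /normal_prob [RHS]integral_mkcond; apply: eq_integral => y _.
rewrite /f patchE; case: ifPn; rewrite ?inE /=.
  by move=> -> /=; rewrite mulr1n mul1r.
by rewrite notin_setE /= => /negP/negbTE ->; rewrite mulr0n mul0r.
Qed.

(** Both sums are integrals of step densities up to the same factor, which cancels in the
    quotient. *)
Lemma narayana_clt (R : realType) (x : R) :
  ((\sum_(1 <= k < n | grid R n k <= x) narayana_weight n k)%:R /
    (\sum_(1 <= k < n) narayana_weight n k)%:R)%:E @[n --> \oo] -->
  normal_prob 0 (Num.sqrt (1 / 8)) `]-oo, x]%classic.
Proof.
have H1 := @integral_step_density_cvg R (fun y => y <= x) x.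
have {H1}H1 : (\int[lebesgue_measure]_y (step_density (fun y => y <= x) n y)%:E)%E @[n --> \oo] -->
  normal_prob 0 (Num.sqrt (1 / 8)) `]-oo, x]%classic.
  have E : `]-oo, x]%classic = [set y | y <= x] by apply/seteqP; split=> y /=; rewrite in_itv.
  rewrite E; apply: H1; first by rewrite -E; exact: measurable_itv.
  move=> y yx; exists (`|y - x| / 2); first by rewrite divr_gt0 // normr_gt0 subr_eq0.
  move=> c; have [xy|yx'] := ltP x y.
    have h : 0 < y - x by rewrite subr_gt0.
    rewrite (gtr0_norm h) ler_norml => /andP[h1 h2].
    by apply/negbTE; rewrite -ltNge; lra.
  have h : y - x < 0 by rewrite subr_lt0 lt_neqAle yx.
  rewrite (ltr0_norm h) ler_norml => /andP[h1 h2].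
  by apply/idP; lra.
(* The total mass: [xpredT] has no jump, so the exceptional point 0 is arbitrary. *)
have H2 := @integral_step_density_cvg R xpredT 0.
have {H2}H2 :
    (\int[lebesgue_measure]_y (step_density (xpredT : R -> bool) n y)%:E)%E @[n --> \oo] --> 1%E.
  have E : [set y : R | xpredT y] = setT by apply/seteqP; split.
  have <- : normal_prob 0 (Num.sqrt (1 / 8 : R)) setT = 1%E.
    by rewrite /normal_prob integral_normal_pdf.
  rewrite -{2}E; apply: H2; first by rewrite E.
  by move=> y _; exists 1.
have fin : normal_prob 0 (Num.sqrt (1 / 8)) `]-oo, x]%classic \is a fin_num.
  exact: (fin_num_measure (normal_prob 0 (Num.sqrt (1 / 8)) : probability (measurableTypeR R) R)).
move: fin H1; move: (normal_prob _ _ _) => [r| |] // _.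
move=> /fine_cvgP[_ H1]; move: H2 => /fine_cvgP[_ H2].
apply: cvg_EFin; first exact: nearW.
rewrite -[r]divr1.
apply: cvg_trans (cvgM H1 (cvgV (oner_neq0 _) H2)); apply: near_eq_cvg.
near=> n.
have n1 : (1 < n)%N by near: n; exact: nbhs_infty_gt.
rewrite /= !integral_step_density /=.
have W0 : (narayana_weight n n./2)%:R != 0 :> R.
  by rewrite pnatr_eq0 -lt0n narayana_weight_gt0 //; lia.
have p0 : normal_peak (Num.sqrt (1 / 8)) != 0 :> R.
  by rewrite gt_eqF // normal_peak_gt0 // gt_eqF // sqrtr_gt0; lra.
have s0 : Num.sqrt n%:R != 0 :> R by rewrite gt_eqF // sqrtn_gt0; lia.
have S0 : (\sum_(1 <= k < n) narayana_weight n k)%:R != 0 :> R.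
  rewrite pnatr_eq0 (bigD1_seq 1%N) ?iota_uniq ?mem_index_iota //=.
  by rewrite -lt0n ltn_addr // narayana_weight_gt0.
by field; rewrite W0 p0 s0 S0.
Unshelve. all: by end_near.
Qed.

(** * The law of the number of lower ends *)

(** An event on a finite type is a finite disjoint union of singletons. *)
Lemma uniform_preimage (R : realType) (d : measure_display) (T : measurableType d)
    (P : probability T R) (E : finType) (A : {set E}) (X : T -> E) (Q : pred E) :
  uniformly_distributed P A X ->
  measurable [set w | Q (X w)] /\
  P [set w | Q (X w)] = (#|[set e in A | Q e]%SET|%:R / #|A|%:R)%:E.
Proof.
move=> [mX PX].
have H (s : seq E) : uniq s -> measurable [set w | X w \in s] /\
    P [set w | X w \in s] = (\sum_(e <- s) (e \in A)%:R / #|A|%:R)%:E.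
  elim: s => [_|e s IH /= /andP[es /IH[ms Ps]]].
    rewrite (_ : [set w | _] = set0) ?measure0 ?big_nil; last by apply/seteqP; split.
    by split.
  have -> : [set w | X w \in e :: s] = X @^-1` [set e] `|` [set w | X w \in s].
    apply/seteqP; split=> w /=; rewrite inE.
      by case/orP=> [/eqP|]; [left | right].
    by case=> ->; rewrite ?eqxx ?orbT.
  split; first exact: measurableU.
  rewrite measureU //; first by rewrite big_cons EFinD; congr (_ + _)%E; [exact: PX | exact: Ps].
  by apply/seteqP; split=> // w [/= ->]; rewrite (negPf es).
have -> : [set w | Q (X w)] = [set w | X w \in enum Q].
  by apply/seteqP; split=> w /=; rewrite mem_enum.
have [mQ ->] := H _ (enum_uniq Q); split=> //; congr EFin.
rewrite -mulr_suml; congr (_ / _).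
rewrite big_enum /= -natr_sum -sum1_card; congr _%:R.
rewrite big_mkcond [RHS]big_mkcond /=; apply: eq_bigr => e _.
by rewrite inE unfold_in andbC; case: (Q e); case: (e \in A).
Qed.

Lemma count_fibers (U : eqType) (f : U -> nat) (Q : pred nat) (s : seq U) (m n : nat) :
  {in s, forall x, (m <= f x < n)%N} ->
  count (fun x => Q (f x)) s = (\sum_(m <= k < n | Q k) count (fun x => f x == k) s)%N.
Proof.
elim: s => [_|x s IH H] /=; first by rewrite big1.
rewrite big_split /= IH => [|y ys]; last by apply: H; rewrite inE ys orbT.
congr addn; rewrite big_mkcond (bigD1_seq (f x)) ?iota_uniq ?mem_index_iota ?H ?mem_head //=.
rewrite eqxx big1 ?addn0; first by case: (Q _).
by move=> k kx; rewrite eq_sym (negPf kx) if_same.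
Qed.

(** The factor [n.-1] is the one of [narayana_countE]. The range of [k] is exhaustive, since a
    nonempty list of [n.-1] edges has between 1 and [n.-1] lower ends. *)
Lemma card_increasing_weight n (Q : pred nat) : (1 < n)%N ->
  (n.-1 * #|[set t in increasing_factorisations n | Q #|lower_ends t|]%SET| =
  \sum_(1 <= k < n | Q k) narayana_weight n k)%N.
Proof.
move=> n1; have n0 := ltnW n1.
rewrite card_increasing_factorisations // (@count_fibers _ _ Q _ 1 n); last first.
  move=> l /(treesP _ n0)/forests_size /=; rewrite size_enum_ord addn1 => ln.
  have sl : size (unzip1 l) = n.-1 by rewrite size_map -[X in X.-1]ln.
  apply/andP; split; last first.
    by apply: leq_ltn_trans (size_undup _) _; rewrite sl; lia.
  case: l {ln} sl => [|p l] /= sl; first by move: n1; rewrite -(prednK n0) -sl.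
  by rewrite /lower_count -has_predT; apply/hasP; exists p.1; rewrite // mem_undup mem_head.
rewrite big_distrr /= big_nat_cond [RHS]big_nat_cond; apply: eq_bigr => k /andP[/andP[k0 kn] _].
by rewrite count_trees -[X in narayana_count X](prednK n0) narayana_countE //; lia.
Qed.

(* Vandermonde, reading C(m, k - 1) as C(m, m + 1 - k). *)
Lemma sum_narayana_weight m :
  (\sum_(1 <= k < m.+1) narayana_weight m.+1 k = 'C(2 * m, m.+1))%N.
Proof.
rewrite mul2n -addnn -binomial.Vandermonde big_ord_recl bin0 subn0 (@bin_small m) // muln0 add0n.
rewrite big_ord_recr /= (@bin_small m (bump 0 m)) // mul0n addn0.
rewrite big_add1 big_mkord; apply: eq_bigr => i _.
rewrite /narayana_weight /= /bump /= add1n subSS; congr muln.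
by rewrite bin_sub // ltnW.
Qed.

Lemma lower_prob (R : realType) (d : measure_display) (T : measurableType d)
    (P : probability T R) (n : nat) (tau : T -> n.-1.-tuple 'S_n) (Q : pred nat) :
  (1 < n)%N -> uniformly_distributed P (increasing_factorisations n) tau ->
  P [set w | Q #|lower_ends (tau w)|] =
  ((\sum_(1 <= k < n | Q k) narayana_weight n k)%:R /
   (\sum_(1 <= k < n) narayana_weight n k)%:R)%:E.
Proof.
move=> n1 U; have [_ ->] := uniform_preimage (fun t => Q #|lower_ends t|) U.
rewrite -card_increasing_weight // -(card_increasing_weight xpredT) //.
rewrite !natrM -mulf_div divff ?mul1r; last by rewrite pnatr_eq0; lia.
by congr ((_ / _%:R)%:E); apply: eq_card => t; rewrite !inE andbT.
Qed.

Lemma increasing_ends n (t : n.-1.-tuple 'S_n) : (1 < n)%N ->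
  t \in increasing_factorisations n -> upper_ends t = (~: lower_ends t)%SET.
Proof.
move=> n1 /(mem_increasing_factorisations _ (ltnW n1))[l lt tE].
apply/setP => a; rewrite finset.in_setC (lower_ends_trees (ltnW n1) lt tE).
by rewrite (upper_ends_trees (ltnW n1) lt tE) (trees_lower_upper _ n1 lt) negbK.
Qed.

(* The source prints (n+1)/(n-1) * C(n-1,k) * C(n-1,k-1) / C(2n,n) for the
   probability in the second item.  Those numbers add up to
   (n+1)/(2(2n-1)) < 1 (for n = 2: 1/2 instead of 1), so the printed formula
   is wrong for every n.  The Catalan number normalising the Narayana numbers
   has index n-1, not n: 1/(n+1) * C(2n,n) has to be 1/n * C(2n-2,n-1). *)
Theorem proposition2 (R : realType) (d : nat -> measure_display)
    (T : forall n : nat, measurableType (d n))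
    (P : forall n : nat, probability (T n) R)
    (tau : forall n : nat, T n -> n.-1.-tuple 'S_n)
    (tau_unif : forall n : nat, (2 <= n)%N ->
      uniformly_distributed (P n) (increasing_factorisations n) (tau n)) :
  (forall n : nat, (2 <= n)%N ->
    {ae P n, forall w,
      (lower_ends (tau n w) :&: upper_ends (tau n w))%SET = finset.set0 /\
      (lower_ends (tau n w) :|: upper_ends (tau n w))%SET = [set: 'I_n]%SET})
  /\
  (forall n k : nat, (2 <= n)%N -> (1 <= k <= n - 1)%N ->
    P n [set w | #|lower_ends (tau n w)| = k] =
    (n%:R / (n - 1)%:R * 'C(n - 1, k)%:R * 'C(n - 1, k - 1)%:R
      / 'C(2 * n - 2, n - 1)%:R)%:E)
  /\
  cvg_in_distribution P
    (fun n w => (#|lower_ends (tau n w)|%:R - n%:R / 2) / Num.sqrt n%:R)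
    (normal_prob 0 (Num.sqrt (1 / 8))).
Proof.
split; [|split].
- move=> n n2.
  have [mQ PQ] := uniform_preimage (fun t => t \notin increasing_factorisations n) (tau_unif n n2).
  (* The exceptional null set consists of the outcomes where [tau n] is not an increasing
     factorisation. *)
  exists [set w | tau n w \notin increasing_factorisations n]; split=> //.
    rewrite PQ (_ : [set e in _ | _]%SET = finset.set0) ?cards0 ?mul0r //.
    by apply/setP => t; rewrite !inE andbN.
  move=> w /= H; apply/negP => tw; apply: H.
  rewrite (increasing_ends n2 tw) finset.setICr; split=> //.
  by apply/setP => a; rewrite !inE orbN.
- move=> n k n2 /andP[k1 kn].
  rewrite (_ : [set w | _] = [set w | pred1 k #|lower_ends (tau n w)|]); last first.
    by apply/seteqP; split=> w /= /eqP.
  rewrite (lower_prob (pred1 k) n2 (tau_unif n n2)); congr EFin.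
  rewrite -big_filter (_ : [seq i <- index_iota 1 n | pred1 k i] = [:: k]); last first.
    by rewrite filter_pred1_uniq ?iota_uniq // mem_index_iota; lia.
  rewrite big_seq1; case: n n2 kn {tau tau_unif P T d} => // m m1 kn.
  rewrite sum_narayana_weight /narayana_weight /= !subn1 /= natrM.
  rewrite (_ : (2 * m.+1 - 2 = 2 * m)%N); last lia.
  (* The relation (m+1) C(2m,m+1) = m C(2m,m) turns the total weight into the central binomial
     coefficient of the statement. *)
  have E := congr1 (fun z => z%:R : R) (mul_bin_left (2 * m) m).
  rewrite (_ : (2 * m - m = m)%N) ?natrM in E; last lia.
  have C1 : 'C(2 * m, m)%:R != 0 :> R by rewrite pnatr_eq0 -lt0n bin_gt0; lia.
  have C2 : 'C(2 * m, m.+1)%:R != 0 :> R by rewrite pnatr_eq0 -lt0n bin_gt0; lia.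
  have m0 : m%:R != 0 :> R by rewrite pnatr_eq0; lia.
  move: E C1 C2 m0; move: ('C(2 * m, m)%:R : R) ('C(2 * m, m.+1)%:R : R) => a b E a0 b0 m0.
  have aE : a = m.+1%:R * b / m%:R by rewrite E; field.
  have : m.+1%:R != 0 :> R by rewrite pnatr_eq0.
  by rewrite aE; move: (m.+1%:R : R) => c c0; field; rewrite m0 b0 c0.
- move=> x _; apply: cvg_trans (@narayana_clt R x); apply: near_eq_cvg.
  near=> n; have n2 : (2 <= n)%N by near: n; exact: nbhs_infty_ge.
  by rewrite -(lower_prob (fun k => grid R n k <= x) n2 (tau_unif n n2)).
Unshelve. all: by end_near.
Qed.
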